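(* Let $\mathcal G'$ be a given subset of $\mathrm{int}(\mathcal G)$, let $\nu_1,\dots,\nu_T$ be generated by the mirror descent algorithm with learning rate $\rho>0$ from the cost functions $f_1,\dots,f_T\in\mathcal F$, and let $D_F(\mathcal G')=\sup_{\nu\in\mathcal G'}D_F(\nu,\nu_1)$. Suppose that the learning rate $\rho$ is such that $\rho\|f_t\|^*_{\nabla F(\nu_t)}\le1/2$ for all $t=1,\dots,T$, and assume that $\|f_t\|^*_{\nabla F(\nu_t)}\le1$ for all $t=1,\dots,T$. Then, for the relaxation $$\widehat V_T(\mathcal G'|f_1,\dots,f_t)=\sup_{\mu\in\mathcal G'}\Big\{\sum_{s=1}^t\langle\mu,-f_s\rangle+\frac1\rho D_F(\mu,\nu_{t+1})\Big\}+2\rho(T-t),\quad t=0,\dots,T,$$ and the corresponding (mirror descent) algorithm, the online learning part of the regret is bounded as $$\sum_{t=1}^T\langle\nu_t,f_t\rangle-\inf_{\nu\in\mathcal G'}\sum_{t=1}^T\langle\nu,f_t\rangle\le\frac{D_F(\mathcal G')}{\rho}+2\rho T.$$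
   Context: $\mathsf X,\mathsf U$ are finite sets (states, actions) and $K(y|x,u)$ is a fixed transition kernel. $\mathcal F$ is a fixed class of functions $\mathsf X\times\mathsf U\to\mathbb R$; $T$ is a fixed finite horizon; $\langle\nu,f\rangle=\sum_{x,u}\nu(x,u)f(x,u)$. State-action polytope: $$\mathcal G=\Big\{\nu\ \text{probability distribution on }\mathsf X\times\mathsf U:\ \sum_{x,u}K(y|x,u)\nu(x,u)=\sum_u\nu(y,u)\ \forall y\in\mathsf X\Big\}.$$ It is taken to be a compact convex subset of $\mathbb R^{|\mathsf X|\times|\mathsf U|}$ with nonempty interior $\mathrm{int}(\mathcal G)$. Let $\mathcal K\subseteq\mathbb R^n$ be closed, convex, with nonempty interior. A function $F:\mathrm{int}(\mathcal K)\to\mathbb R$ is a barrier on $\mathcal K$ if $F(x_i)\to+\infty$ along any sequence of points of $\mathrm{int}(\mathcal K)$ converging to a boundary point of $\mathcal K$. It is self-concordant if it is convex, $C^3$, and $\nabla^3F(v)[h,h,h]\le2(\nabla^2F(v)[h,h])^{3/2}$ for all $v\in\mathrm{int}(\mathcal K)$, $h\in\mathbb R^n$. The Bregman divergence is $D_F(v,w)=F(v)-F(w)-\langle\nabla F(w),v-w\rangle$, $v,w\in\mathrm{int}(\mathcal K)$. The Legendre–Fenchel dual is $F^*(h)=\sup_{v\in\mathrm{int}(\mathcal K)}\{\langle h,v\rangle-F(v)\}$, and the dual local norm of $f$ at $h$ is $\|f\|^*_h=\sqrt{\langle f,\nabla^2F^*(h)f\rangle}$. Standing assumption (with $\mathcal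 K=\mathcal G$): $\mathcal G$ admits a self-concordant barrier $F:\mathrm{int}(\mathcal G)\to\mathbb R$ such that (1) $F$ is strictly convex on $\mathrm{int}(\mathcal G)$ and $F^*$ is strictly convex on $\mathbb R^{|\mathsf X|\times|\mathsf U|}$; (2) the gradient map $\nu\mapsto\nabla F(\nu)$ is a bijection between $\mathrm{int}(\mathcal G)$ and $\mathbb R^{|\mathsf X|\times|\mathsf U|}$ with inverse $h\mapsto\nabla F^*(h)$; (3) the minimum value of $F$ on $\mathrm{int}(\mathcal G)$ is $0$. Mirror descent algorithm with learning rate $\rho>0$: $\nu_1=\operatorname{arg\,min}_{\nu\in\mathrm{int}(\mathcal G)}F(\nu)$ and, for $t\ge2$, $\nu_t=\nabla F^*\big(\nabla F(\nu_{t-1})-\rho f_{t-1}\big)$.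
   Formalization: Since G lies in a hyperplane, its interior is empty; int(G) is read as the relative interior, ∇F is taken along (and valued in) the direction space of G's affine hull, and bijectivity of ∇F and strict convexity of F* are assumed on that space instead of R^{|X|×|U|}. *)

(* Defs.v *)
From HB Require Import structures.
From mathcomp Require Import all_boot all_order all_algebra.
From mathcomp Require Import all_classical all_reals all_analysis.

Set Implicit Arguments.
Unset Strict Implicit.
Unset Printing Implicit Defensive.
Import Order.TTheory GRing.Theory Num.Theory.
Import numFieldNormedType.Exports.
Local Open Scope classical_set_scope.
Local Open Scope ring_scope.

(* Convention for "int" and gradients.
   The state-action polytope lies in the hyperplane of matrices whose entries
   sum to 1, so its interior in the ambient space is empty (see
   [interior_state_action_polytope]).  As usual for polytopes, "int" is the
   relative interior, and the space on which F is differentiated and in which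
   its gradient takes values is the direction of the affine hull.  For a set
   with nonempty ambient interior these are the ambient interior and the whole
   space ([relint_full], [direction_full]). *)
Section RelativeInterior.
Context {R : realType} {V : normedModType R}.
Implicit Types A : set V.

Definition affine_hull A : set V :=
  [set v | exists (k : nat) (c : 'I_k -> R) (w : 'I_k -> V),
     [/\ forall i, A (w i), \sum_i c i = 1 & v = \sum_i c i *: w i]].

Definition direction A : set V :=
  [set v - w | v in affine_hull A & w in affine_hull A].

Definition relint A : set V :=
  [set v | A v /\ \forall w \near v, affine_hull A w -> A w].

Lemma interior_ray A v h : A° v -> exists2 t : R, 0 < t & A (v + t *: h).
Proof.
move=> Av.
have cvt : (fun t : R => v + t *: h) t @[t --> 0] --> v.
  rewrite -[X in _ --> X]addr0 -[X in _ --> _ + X](scale0r h).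
  by apply: cvgD; [exact: cvg_cst|apply: cvgZr_tmp; exact: cvg_id].
have /nbhs_ballP[e /= e0 eA] : \forall t \near (0 : R), A (v + t *: h).
  exact: cvt _ Av.
exists (e / 2); first by rewrite divr_gt0.
apply: eA; rewrite /ball /= sub0r normrN gtr0_norm ?divr_gt0//.
by rewrite gtr_pMr// invf_lt1// ltr1n.
Qed.

Lemma affine_hull_full A : A° !=set0 -> affine_hull A = setT.
Proof.
move=> [v Av]; apply/seteqP; split=> // y _.
have [t t_gt0 At] := interior_ray (y - v) Av.
have t0 : t != 0 by rewrite gt_eqF.
have Avv : A v by exact: nbhs_singleton Av.
exists 2%N, (fun i => if i == 0 then t^-1 else 1 - t^-1).
exists (fun i => if i == 0 then v + t *: (y - v) else v); split.
- by move=> i; case: ifP.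
- by rewrite !big_ord_recl big_ord0 /= addr0 addrC subrK.
- rewrite !big_ord_recl big_ord0 /= addr0 scalerDr scalerA mulVf// scale1r.
  by rewrite scalerBl scale1r [RHS]addrC addrA subrK addrC subrK.
Qed.

Lemma direction_full A : A° !=set0 -> direction A = setT.
Proof.
move=> /affine_hull_full hA; apply/seteqP; split=> // y _.
by exists y; rewrite ?hA//; exists 0; rewrite ?hA// subr0.
Qed.

Lemma relint_full A : A° !=set0 -> relint A = A°.
Proof.
move=> /affine_hull_full hA; apply/seteqP; split=> v.
  by move=> [_ Av]; apply: filterS Av => w; apply; rewrite hA.
by move=> Av; split; [exact: nbhs_singleton Av|exact: filterS Av].
Qed.

End RelativeInterior.

Section Barriers.
Context {R : realType} {n m : nat}.
Local Notation E := 'M[R]_(n, m).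
Implicit Types (K D : set E) (F : E -> R) (v w h f g : E).

Definition pairing v f : R := \sum_i \sum_j v i j * f i j.

(* Functions on int(K) are total functions on E; only their values on
   [relint K] are ever used, since they are differentiated only at points of
   [relint K] along [direction K]. *)

Definition barrier K F : Prop :=
  forall (u : nat -> E) (p : E),
    (forall i, relint K (u i)) -> (closure K `\` relint K) p ->
    u i @[i --> \oo] --> p -> F (u i) @[i --> \oo] --> +oo.

(* C^k through iterated directional derivatives *)
Fixpoint smooth k K F : Prop :=
  match k with
  | 0 => {within relint K, continuous F}
  | k'.+1 => forall h, direction K h ->
      (forall v, relint K v -> derivable F v h) /\ smooth k' K ('D_h F)
  end.

Definition self_concordant K F : Prop :=
  [/\ convex_function (relint K) F, smooth 3 K F
    & forall v h, relint K v -> direction K h ->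
        'D_h ('D_h ('D_h F)) v <= 2 * ('D_h ('D_h F) v) `^ (3 / 2)].

(* [gradient_on D F v] represents, within the linear subspace D, the
   derivative of F at v along D; with D = setT it is the usual gradient.
   The default 0 is returned when there is no such vector. *)
Definition gradient_on D F v : E :=
  xget 0 [set g | D g /\ forall h, D h -> is_derive v h F (pairing g h)].

Definition gradient K F : E -> E := gradient_on (direction K) F.

Definition bregman K F v w : R :=
  F v - F w - pairing (gradient K F w) (v - w).

(* A real supremum: finite when K is bounded and F is bounded below. *)
Definition conjugate K F h : R :=
  sup [set pairing h v - F v | v in relint K].

Definition conj_gradient K F : E -> E := gradient_on setT (conjugate K F).

(* <f, Hessian f> is the second directional derivative along f *)
Definition dual_norm K F h f : R :=
  Num.sqrt ('D_f ('D_f (conjugate K F)) h).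

Definition strictly_convex D F : Prop :=
  forall v w (t : R), D v -> D w -> v != w -> 0 < t -> t < 1 ->
    F (t *: v + (1 - t) *: w) < t * F v + (1 - t) * F w.

(* Adding to h a vector orthogonal to [direction K] only adds a constant to
   h |-> <h, v> on [relint K]: the conjugate is affine in these variables, and
   its strict convexity and the bijectivity of the gradient are meant on
   [direction K]. *)
Definition mirror_barrier K F : Prop :=
  [/\ barrier K F, self_concordant K F,
      strictly_convex (relint K) F /\
        strictly_convex (direction K) (conjugate K F),
      [/\ set_bij (relint K) (direction K) (gradient K F),
          forall v, relint K v -> conj_gradient K F (gradient K F v) = v
        & forall h, direction K h -> gradient K F (conj_gradient K F h) = h]
    & (exists2 v, relint K v & F v = 0) /\ (forall v, relint K v -> 0 <= F v)].

(* [nu T.+1] is included because it enters the relaxation at t = T. *)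
Definition mirror_descent K F (rho : R) (T : nat) (f nu : nat -> E) : Prop :=
  [/\ relint K (nu 1%N), forall v, relint K v -> F (nu 1%N) <= F v
    & forall t, (2 <= t <= T.+1)%N ->
        nu t = conj_gradient K F (gradient K F (nu t.-1) - rho *: f t.-1)].

Local Open Scope ereal_scope.

Definition bregman_radius K F (nu1 : E) (G' : set E) : \bar R :=
  ereal_sup [set (bregman K F v nu1)%:E | v in G'].

Definition mirror_relaxation K F (rho : R) (T : nat) (f nu : nat -> E)
    (G' : set E) (t : nat) : \bar R :=
  ereal_sup [set (\sum_(1 <= s < t.+1) pairing mu (- f s) +
                  rho^-1 * bregman K F mu (nu t.+1))%R%:E | mu in G']
  + (2 * rho * (T - t)%:R)%R%:E.

Definition online_regret (T : nat) (f nu : nat -> E) (G' : set E) : \bar R :=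
  (\sum_(1 <= t < T.+1) pairing (nu t) (f t))%R%:E
  - ereal_inf [set (\sum_(1 <= t < T.+1) pairing v (f t))%R%:E | v in G'].

End Barriers.

Section Polytope.
Context {R : realType} {n m : nat}.

(* X = 'I_n, U = 'I_m and [K x u y] is K(y | x, u). *)
Definition transition_kernel (K : 'I_n -> 'I_m -> 'I_n -> R) : Prop :=
  forall x u, (forall y, 0 <= K x u y) /\ \sum_y K x u y = 1.

Definition state_action_polytope (K : 'I_n -> 'I_m -> 'I_n -> R) :
    set 'M[R]_(n, m) :=
  [set nu | [/\ forall x u, 0 <= nu x u, \sum_x \sum_u nu x u = 1
    & forall y, \sum_x \sum_u K x u y * nu x u = \sum_u nu y u]].

Lemma interior_state_action_polytope (K : 'I_n -> 'I_m -> 'I_n -> R) :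
  (state_action_polytope K)° = set0.
Proof.
apply/seteqP; split=> // v Gv.
have [_ v1 _] : state_action_polytope K v by exact: nbhs_singleton Gv.
have [t t_gt0 [_ + _]] := interior_ray v Gv.
under eq_bigr do under eq_bigr do rewrite !mxE.
under eq_bigr do rewrite big_split /= -mulr_sumr.
rewrite big_split /= -mulr_sumr v1 mulr1 => /eqP.
by rewrite -subr_eq0 addrAC subrr add0r gt_eqF.
Qed.

End Polytope.

(* Main.v *)
(* Write |k|_v for the local norm sqrt (D^2 F(v)[k, k]) and |f|_v* for its dual
   norm sup <f, k> / |k|_v.  Along a line, self-concordance says that
   1 / sqrt (g'') is 1-Lipschitz, so F(v + k) - F(v) - <grad F(v), k> lies between
   r^2 / (2 (1 + r)) and r^2 / (2 (1 - r)^2) with r = |k|_v.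
   For one mirror step from v to w with k = w - v this gives
   D_F(v, w) = - rho <f, k> - D_F(w, v) <= a r - r^2 / (2 (1 + r)) <= 2 a^2,
   where a = rho |f|_v* <= 1/2, and the three-point identity for Bregman
   divergences telescopes to the regret bound.
   It remains to identify |f|_v* with [dual_norm], i.e. with the second
   derivative of F* at grad F(v).  The two bounds above dualise to a second-order
   expansion of s |-> F*(grad F(v) + s f) at 0 with coefficient |f|_v*^2; since F*
   is convex, this forces the second derivative to exist and have that value. *)
Require Import Defs.
From mathcomp Require Import all_boot all_order all_algebra.
From mathcomp Require Import all_classical all_reals all_analysis.
From mathcomp Require Import ring lra.
Set Implicit Arguments.
Unset Strict Implicit.
Unset Printing Implicit Defensive.
Import Order.TTheory GRing.Theory Num.Theory.
Import numFieldNormedType.Exports.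
Local Open Scope classical_set_scope.
Local Open Scope ring_scope.

(** * Self-concordant functions of one real variable *)

Section SelfConcordantLine.
Context {R : realType}.
Implicit Types (f df g dg p dp : R -> R) (a b t x : R).

Lemma MVT_is_derive f df a b : a <= b ->
  (forall x, a <= x <= b -> is_derive x 1 f (df x)) ->
  exists2 c, a <= c <= b & f b - f a = df c * (b - a).
Proof.
move=> ab fE.
have fD x : x \in `]a, b[ -> is_derive x 1 f (df x).
  by rewrite in_itv/= => /andP[ax xb]; apply: fE; rewrite !ltW.
have fC : {within `[a, b], continuous f}.
  by apply: derivable_within_continuous => x; rewrite in_itv/= => /fE[].
have [c c_ab fba] := MVT_segment ab fD fC.
by exists c => //; move: c_ab; rewrite in_itv.
Qed.

Lemma derive_ge0_le f df a b : a <= b ->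
  (forall x, a <= x <= b -> is_derive x 1 f (df x)) ->
  (forall x, a <= x <= b -> 0 <= df x) -> f a <= f b.
Proof.
move=> ab fE df0; have [c c_ab fba] := MVT_is_derive ab fE.
by rewrite -subr_ge0 fba mulr_ge0 ?subr_ge0 ?df0.
Qed.

(* Adding e > 0 to p avoids dividing by zero; e is sent to 0 afterwards. *)
Lemma inv_sqrt_lipschitz p dp b e : 0 <= b -> 0 < e ->
  (forall x, 0 <= x <= b -> is_derive x 1 p (dp x)) ->
  (forall x, 0 <= x <= b -> 0 <= p x) ->
  (forall x, 0 <= x <= b -> `|dp x| <= 2 * (p x * Num.sqrt (p x))) ->
  `|(Num.sqrt (p b + e))^-1 - (Num.sqrt (p 0 + e))^-1| <= b.
Proof.
move=> b0 e0 pE p0 dp_le.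
have pe0 x : 0 <= x <= b -> 0 < p x + e by move=> xb; rewrite ltr_wpDl ?p0.
pose S x := Num.sqrt (p x + e).
have S0 x : 0 <= x <= b -> 0 < S x by move=> xb; rewrite sqrtr_gt0 pe0.
have SE x : 0 <= x <= b ->
    is_derive x 1 (fun y => (S y)^-1) (- (S x) ^- 2 *: ((2 * S x)^-1 * dp x)).
  move=> xb; apply: is_deriveV; first by rewrite gt_eqF ?S0.
  apply: (@is_derive1_comp R Num.sqrt (fun y => p y + e)).
    exact: is_derive1_sqrt (pe0 _ xb).
  by have := pE _ xb => ?; apply: is_derive_eq; rewrite addr0.
have [c c_b ->] := MVT_is_derive b0 SE.
rewrite subr0 normrM (ger0_norm b0) ler_piMl//.
have Sc := S0 _ c_b.
rewrite /GRing.scale /= !(normrM, normfV, normrN, normrX) (gtr0_norm Sc) normr_nat.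
rewrite mulrA -invfM mulrC ler_pdivrMr ?mul1r ?mulr_gt0 ?exprn_gt0//.
apply: (le_trans (dp_le _ c_b)).
have -> : S c ^+ 2 * (2 * S c) = 2 * ((p c + e) * S c).
  by rewrite /S sqr_sqrtr ?(ltW (pe0 _ c_b))//; ring.
rewrite ler_pM2l//; apply: ler_pM; rewrite ?p0 ?sqrtr_ge0 ?lerDl ?(ltW e0)//.
by rewrite ler_wsqrtr// lerDl ltW.
Qed.

(** Cross-multiplied form of the Lipschitz bound on [1 / sqrt p], so that it still makes sense where
    [p] vanishes. *)
Lemma sqrt_self_concordant p dp b : 0 <= b ->
  (forall x, 0 <= x <= b -> is_derive x 1 p (dp x)) ->
  (forall x, 0 <= x <= b -> 0 <= p x) ->
  (forall x, 0 <= x <= b -> `|dp x| <= 2 * (p x * Num.sqrt (p x))) ->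
  let r := Num.sqrt (p 0) in
  r <= Num.sqrt (p b) * (1 + r * b) /\ Num.sqrt (p b) * (1 - r * b) <= r.
Proof.
move=> b0 pE p0 dp_le r; set x := Num.sqrt (p b).
have r0 : 0 <= r by exact: sqrtr_ge0.
have x0 : 0 <= x by exact: sqrtr_ge0.
have pb0 : 0 <= p b by rewrite p0// b0 lexx.
have p00 : 0 <= p 0 by rewrite p0// b0 lexx.
(* With regularisation [d ^+ 2], the regularised root exceeds the true one by at most [d]. *)
have key d : 0 < d -> d <= 1 ->
    r <= (x + d) * (1 + (r + d) * b) /\ x * (1 - (r + d) * b) <= r + d.
  move=> d0 d1; have e0 : 0 < d ^+ 2 by rewrite exprn_gt0.
  have := inv_sqrt_lipschitz b0 e0 pE p0 dp_le.
  have sqrtD q : 0 <= q ->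
      Num.sqrt q <= Num.sqrt (q + d ^+ 2) <= Num.sqrt q + d /\
      0 < Num.sqrt (q + d ^+ 2).
    move=> q0; rewrite sqrtr_gt0 ltr_wpDl// ler_wsqrtr ?lerDl ?(ltW e0)//=.
    split=> //.
    rewrite -(ler_pXn2r (isT : (0 < 2)%N)) ?nnegrE ?sqrtr_ge0 ?addr_ge0 ?sqrtr_ge0 ?(ltW d0)//.
    rewrite sqr_sqrtr ?addr_ge0 ?(ltW e0)// sqrrD sqr_sqrtr// lerD2r lerDl.
    by rewrite mulrn_wge0 ?mulr_ge0 ?sqrtr_ge0 ?(ltW d0).
  have [/andP[]] := sqrtD _ pb0; have [/andP[]] := sqrtD _ p00.
  rewrite -/r -/x; set X := Num.sqrt (p b + _); set Y := Num.sqrt (p 0 + _).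
  move=> rY Yr Y0 xX Xx X0; rewrite ler_norml => /andP[lo hi].
  have XY0 : 0 < X * Y by rewrite mulr_gt0.
  have eqXY : (X^-1 - Y^-1) * (X * Y) = Y - X.
    by rewrite mulrBl mulrA mulVf ?gt_eqF// mul1r mulrCA mulVf ?gt_eqF// mulr1.
  have {}lo : - b * (X * Y) <= Y - X by rewrite -eqXY ler_pM2r.
  have {}hi : Y - X <= b * (X * Y) by rewrite -eqXY ler_pM2r.
  split.
    apply: (le_trans rY); apply: (@le_trans _ _ (X * (1 + Y * b))); first by nra.
    apply: ler_pM => //; [exact: ltW | by rewrite addr_ge0// mulr_ge0// ltW |].
    by rewrite lerD2l ler_wpM2r.
  have [le0|/ltW ge0] := lerP (1 - Y * b) 0.
    apply: (@le_trans _ _ 0); last by rewrite addr_ge0// ltW.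
    apply: mulr_ge0_le0 => //; apply: le_trans le0.
    by rewrite lerD2l lerN2 ler_wpM2r.
  apply: (le_trans _ Yr); apply: (@le_trans _ _ (X * (1 - Y * b))); last by nra.
  apply: (@le_trans _ _ (x * (1 - Y * b))); last by rewrite ler_wpM2r.
  by rewrite ler_wpM2l// lerD2l lerN2 ler_wpM2r.
split; apply/ler_addgt0Pr => e e0.
  (* [C] bounds the coefficient of [d] in the error of [key]; the term [d * (d * b)] is absorbed
     through [d <= 1]. *)
  pose C := 1 + r * b + b + x * b.
  have C0 : 0 < C by rewrite /C; nra.
  pose d := Num.min 1 (e / C).
  have d1 : d <= 1 by rewrite /d ge_min lexx.
  have d0 : 0 < d by rewrite /d lt_min ltr01 divr_gt0.
  have dC : d * C <= e by rewrite -ler_pdivlMr// /d ge_min lexx orbT.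
  have [H _] := key _ d0 d1; apply: (le_trans H).
  have : d * (d * b) <= d * b by rewrite ler_piMl ?mulr_ge0// ltW.
  rewrite /C in dC; nra.
pose C := 1 + x * b.
have C0 : 0 < C by rewrite /C; nra.
pose d := Num.min 1 (e / C).
have d1 : d <= 1 by rewrite /d ge_min lexx.
have d0 : 0 < d by rewrite /d lt_min ltr01 divr_gt0.
have dC : d * C <= e by rewrite -ler_pdivlMr// /d ge_min lexx orbT.
have [_ H] := key _ d0 d1; rewrite /C in dC; nra.
Qed.

(** The bound [r ^+ 2 / (1 + r * x) ^+ 2] on [p] is integrated twice, each time as monotonicity of a
    difference. *)
Lemma self_concordant_lower g dg p dp b : 0 <= b ->
  (forall x, 0 <= x <= b -> is_derive x 1 g (dg x)) ->
  (forall x, 0 <= x <= b -> is_derive x 1 dg (p x)) ->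
  (forall x, 0 <= x <= b -> is_derive x 1 p (dp x)) ->
  (forall x, 0 <= x <= b -> 0 <= p x) ->
  (forall x, 0 <= x <= b -> `|dp x| <= 2 * (p x * Num.sqrt (p x))) ->
  g 0 + dg 0 * b +
    (Num.sqrt (p 0) * b) ^+ 2 / (2 * (1 + Num.sqrt (p 0) * b)) <= g b.
Proof.
move=> b0 gE dgE pE p0 dp_le; set r := Num.sqrt (p 0).
have r0 : 0 <= r by exact: sqrtr_ge0.
have rx x : 0 <= x -> 0 < 1 + r * x by move=> x0; rewrite ltr_pwDl// mulr_ge0.
have p_ge x : 0 <= x <= b -> r ^+ 2 / (1 + r * x) ^+ 2 <= p x.
  move=> /andP[x0 xb].
  have [||||+ _] := @sqrt_self_concordant p dp x => //.
  - by move=> y /andP[? yx]; apply: pE; rewrite (le_trans yx)// andbT.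
  - by move=> y /andP[? yx]; apply: p0; rewrite (le_trans yx)// andbT.
  - by move=> y /andP[? yx]; apply: dp_le; rewrite (le_trans yx)// andbT.
  rewrite -/r -expr_div_n => h.
  rewrite -[leRHS]sqr_sqrtr ?p0 ?x0//.
  rewrite ler_pXn2r ?nnegrE ?sqrtr_ge0 ?divr_ge0 ?(ltW (rx _ _))//.
  by rewrite ler_pdivrMr ?rx.
have dg_ge x : 0 <= x <= b -> dg 0 + r ^+ 2 * x / (1 + r * x) <= dg x.
  move=> /andP[x0 xb].
  have := @derive_ge0_le (fun y => dg y - r ^+ 2 * y * (1 + r * y)^-1)
    (fun y => p y - r ^+ 2 / (1 + r * y) ^+ 2) 0 x x0.
  rewrite !mulr0 mul0r subr0 -lerBrDr; apply.
    move=> y /andP[y0 yx].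
    have ? : is_derive y 1 dg (p y) by apply: dgE; rewrite y0 (le_trans yx).
    have ry := rx _ y0.
    have ? : is_derive y 1 (fun z => (1 + r * z)^-1) (- (1 + r * y) ^- 2 *: r).
      apply: is_deriveV; first by rewrite gt_eqF.
      by apply: is_derive_eq; rewrite /GRing.scale /=; ring.
    apply: is_derive_eq.
    rewrite /GRing.scale /=; field; rewrite gt_eqF//.
  move=> y /andP[y0 yx].
  by rewrite subr_ge0 p_ge// y0 (le_trans yx).
(* The exact second primitive is [r b - ln (1 + r b)]; a rational minorant replaces it, whose
   derivative stays below [r ^+ 2 * y / (1 + r * y)]. *)
have := @derive_ge0_le (fun y => g y - dg 0 * y - (r * y) ^+ 2 * (2 * (1 + r * y))^-1)
    (fun y => dg y - dg 0 - r * (r * y * (2 + r * y)) / (2 * (1 + r * y) ^+ 2)) 0 b b0.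
rewrite !mulr0 expr0n mul0r !subr0 => H.
rewrite -lerBrDr -lerBrDr addrAC; apply: H.
  move=> y yb.
  have ? : is_derive y 1 g (dg y) by apply: gE.
  have ry : 0 < 1 + r * y by apply: rx; case/andP: yb.
  have ? : is_derive y 1 (fun z => (2 * (1 + r * z))^-1)
      (- (2 * (1 + r * y)) ^- 2 *: (2 * r)).
    apply: is_deriveV; first by rewrite gt_eqF// mulr_gt0.
    by apply: is_derive_eq; rewrite /GRing.scale /=; ring.
  apply: is_derive_eq.
  rewrite /GRing.scale /=; field; rewrite gt_eqF//.
move=> y yb; have := dg_ge _ yb; rewrite -lerBrDl => h.
have y0 : 0 <= y by case/andP: yb.
have ry := rx _ y0.
rewrite subr_ge0; apply: le_trans h.
rewrite ler_pdivrMr ?mulr_gt0 ?exprn_gt0// [leRHS]mulrAC ler_pdivlMr//.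
have -> : r ^+ 2 * y * (2 * (1 + r * y) ^+ 2) =
   r * (r * y * (2 + r * y)) * (1 + r * y) + r * (r * y) * (r * y) * (1 + r * y).
  by ring.
by rewrite lerDl !mulr_ge0// ltW.
Qed.

(** On the whole interval [p] is at most the constant [M], the bound reached at [b], so integrating
    twice costs [M / 2 * b ^+ 2]. *)
Lemma self_concordant_upper g dg p dp b : 0 <= b ->
  (forall x, 0 <= x <= b -> is_derive x 1 g (dg x)) ->
  (forall x, 0 <= x <= b -> is_derive x 1 dg (p x)) ->
  (forall x, 0 <= x <= b -> is_derive x 1 p (dp x)) ->
  (forall x, 0 <= x <= b -> 0 <= p x) ->
  (forall x, 0 <= x <= b -> `|dp x| <= 2 * (p x * Num.sqrt (p x))) ->
  Num.sqrt (p 0) * b < 1 ->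
  g b <= g 0 + dg 0 * b +
    (Num.sqrt (p 0) * b) ^+ 2 / (2 * (1 - Num.sqrt (p 0) * b) ^+ 2).
Proof.
move=> b0 gE dgE pE p0 dp_le; set r := Num.sqrt (p 0) => rb1.
have r0 : 0 <= r by exact: sqrtr_ge0.
pose M := r ^+ 2 / (1 - r * b) ^+ 2.
have rb0 : 0 < 1 - r * b by rewrite subr_gt0.
have p_le x : 0 <= x <= b -> p x <= M.
  move=> /andP[x0 xb].
  have [||||_ +] := @sqrt_self_concordant p dp x => //.
  - by move=> y /andP[? yx]; apply: pE; rewrite (le_trans yx)// andbT.
  - by move=> y /andP[? yx]; apply: p0; rewrite (le_trans yx)// andbT.
  - by move=> y /andP[? yx]; apply: dp_le; rewrite (le_trans yx)// andbT.
  rewrite -/r => h.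
  rewrite /M -expr_div_n -[leLHS]sqr_sqrtr ?p0 ?x0//.
  rewrite ler_pXn2r ?nnegrE ?sqrtr_ge0 ?divr_ge0 ?(ltW rb0)//.
  rewrite ler_pdivlMr//; apply: le_trans h.
  by rewrite ler_wpM2l ?sqrtr_ge0// lerD2l lerN2 ler_wpM2l.
have dg_le x : 0 <= x <= b -> dg x <= dg 0 + M * x.
  move=> /andP[x0 xb].
  have := @derive_ge0_le (fun y => M * y - dg y) (fun y => M - p y) 0 x x0.
  move=> H; suff : M * 0 - dg 0 <= M * x - dg x by lra.
  apply: H.
    move=> y /andP[y0 yx].
    have ? : is_derive y 1 dg (p y) by apply: dgE; rewrite y0 (le_trans yx).
    by apply: is_derive_eq; rewrite /GRing.scale /=; ring.
  by move=> y /andP[y0 yx]; rewrite subr_ge0 p_le// y0 (le_trans yx).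
have := @derive_ge0_le (fun y => dg 0 * y + M / 2 * y ^+ 2 - g y)
    (fun y => dg 0 + M * y - dg y) 0 b b0.
move=> H.
have -> : (r * b) ^+ 2 / (2 * (1 - r * b) ^+ 2) = M / 2 * b ^+ 2.
  by rewrite /M; field; rewrite gt_eqF//.
suff : dg 0 * 0 + M / 2 * 0 ^+ 2 - g 0 <= dg 0 * b + M / 2 * b ^+ 2 - g b.
  by rewrite mulr0 expr0n mulr0; lra.
apply: H.
  move=> y yb; have ? : is_derive y 1 g (dg y) by apply: gE.
  by apply: is_derive_eq; rewrite /GRing.scale /=; field.
by move=> y yb; rewrite subr_ge0 dg_le.
Qed.

End SelfConcordantLine.

(** * Affine hulls, directions and relative interiors *)

Section AffineGeometry.
Context {R : realType} {V : normedModType R}.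
Implicit Types (A : set V) (v w x y h k : V) (a b t : R).

Lemma mem_affine_hull A v : A v -> affine_hull A v.
Proof.
move=> Av; exists 1%N, (fun=> 1), (fun=> v); split=> //.
  by rewrite big_ord1.
by rewrite big_ord1 scale1r.
Qed.

Lemma affine_hull_line A x y a : affine_hull A x -> affine_hull A y ->
  affine_hull A (a *: x + (1 - a) *: y).
Proof.
move=> [k [c [w [Aw c1 ->]]]] [l [d [z [Az d1 ->]]]].
exists (k + l)%N.
exists (fun i => match fintype.split i with inl j => a * c j | inr j => (1 - a) * d j end).
exists (fun i => match fintype.split i with inl j => w j | inr j => z j end); split.
- by move=> i; case: fintype.split.
- rewrite big_split_ord/=.
  under eq_bigr do rewrite (unsplitK (inl _)).
  under [X in _ + X]eq_bigr do rewrite (unsplitK (inr _)).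
  by rewrite -!mulr_sumr c1 d1 !mulr1 addrC subrK.
- rewrite big_split_ord/=.
  under [X in _ = X + _]eq_bigr do rewrite (unsplitK (inl _)).
  under [X in _ = _ + X]eq_bigr do rewrite (unsplitK (inr _)).
  by rewrite !scaler_sumr; congr (_ + _); apply: eq_bigr => i _; rewrite scalerA.
Qed.

Lemma affine_hull_add A x v w a : affine_hull A x -> affine_hull A v ->
  affine_hull A w -> affine_hull A (x + a *: (v - w)).
Proof.
move=> Ax Av Aw.
(* The midpoint of a point on the line through [x] and [v] and one on the line through [x] and [w],
   so closure under lines suffices. *)
have -> : x + a *: (v - w) = 2^-1 *: ((a *+ 2) *: v + (1 - a *+ 2) *: x) +
    (1 - 2^-1) *: ((- (a *+ 2)) *: w + (1 - - (a *+ 2)) *: x).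
  have -> : 1 - 2^-1 = 2^-1 :> R by field.
  rewrite -scalerDr addrACA -scalerDl.
  have -> : 1 - a *+ 2 + (1 - a *- 2) = 2 :> R by ring.
  rewrite scaleNr -scalerBr [RHS]scalerDr !scalerA mulVf// scale1r addrC.
  by have -> : 2^-1 * (a *+ 2) = a by field.
by do 2!apply: affine_hull_line => //.
Qed.

Lemma affine_hull_direction A x h : affine_hull A x -> direction A h ->
  affine_hull A (x + h).
Proof.
move=> Ax [v Av [w Aw <-]].
by rewrite -[v - w]scale1r; exact: affine_hull_add.
Qed.

Lemma directionB A v w : A v -> A w -> direction A (v - w).
Proof.
by move=> Av Aw; exists v; [|exists w => //]; exact: mem_affine_hull.
Qed.

Lemma directionDZ A h k a : direction A h -> direction A k ->
  direction A (h + a *: k).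
Proof.
move=> [v Av [w Aw <-]] [x Ax [y Ay <-]].
exists (v + a *: (x - y)); first exact: affine_hull_add.
by exists w => //; rewrite addrAC.
Qed.

Lemma direction0 A : A !=set0 -> direction A 0.
Proof. by move=> [v Av]; rewrite -(subrr v); exact: directionB. Qed.

Lemma directionZ A h a : A !=set0 -> direction A h -> direction A (a *: h).
Proof.
by move=> A0 Ah; rewrite -[_ *: _]add0r; apply: directionDZ => //; exact: direction0.
Qed.

Lemma directionN A h : A !=set0 -> direction A h -> direction A (- h).
Proof. by rewrite -scaleN1r; exact: directionZ. Qed.

Lemma relintW A v : relint A v -> A v. Proof. by case. Qed.

Lemma near_relint A v : relint A v ->
  \forall w \near v, affine_hull A w -> relint A w.
Proof.
move=> [_ /nbhs_interior]; apply: filterS => w wA hw.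
by split; [exact: (nbhs_singleton wA)|exact: wA].
Qed.

Lemma near_relint_line A v h : relint A v -> direction A h ->
  \forall t \near (0 : R), relint A (v + t *: h).
Proof.
move=> Av Ah.
have A0 : A !=set0 by exists v; exact: relintW.
have cvt : (fun t : R => v + t *: h) t @[t --> 0] --> v.
  rewrite -[X in _ --> X]addr0 -[X in _ --> _ + X](scale0r h).
  by apply: cvgD; [exact: cvg_cst|apply: cvgZr_tmp; exact: cvg_id].
have : \forall t \near (0 : R), affine_hull A (v + t *: h) -> relint A (v + t *: h).
  exact: cvt _ (near_relint Av).
apply: filterS => t; apply.
by apply: affine_hull_direction; [exact: mem_affine_hull (relintW Av)|exact: directionZ].
Qed.

Lemma convex_setW A v w t : convex_set A -> A v -> A w -> 0 <= t <= 1 ->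
  A (t *: v + (1 - t) *: w).
Proof.
move=> cA Av Aw t01.
have := cA v w (Itv01 (andP t01).1 (andP t01).2).
by rewrite !inE => /(_ Av Aw).
Qed.

(** A point [y] of the hull near [u] is the same convex combination of [v] and [w], both translated
    by the small direction [y - u]. *)
Lemma relint_convex A v w t : convex_set A -> relint A v -> relint A w ->
  0 <= t <= 1 -> relint A (t *: v + (1 - t) *: w).
Proof.
move=> cA Av Aw t01; set u := t *: v + (1 - t) *: w.
split; first by apply: convex_setW => //; exact: relintW.
have shift z : (fun y : V => z + (y - u)) y @[y --> u] --> z.
  rewrite -[X in _ --> X]addr0 -[X in _ --> _ + X](subrr u).
  by apply: cvgD; [exact: cvg_cst|apply: cvgB; [exact: cvg_id|exact: cvg_cst]].
have hull z : relint A z -> affine_hull A z.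
  by move=> /relintW; exact: mem_affine_hull.
have uA : affine_hull A u by apply: affine_hull_line; exact: hull.
have near_shift z : relint A z ->
    \forall y \near u, affine_hull A (z + (y - u)) -> A (z + (y - u)).
  by move=> [_ Az]; exact: shift z _ Az.
apply: filterS2 (near_shift v Av) (near_shift w Aw) => y yv yw hy.
have dy : direction A (y - u) by exists y => //; exists u.
have -> : y = t *: (v + (y - u)) + (1 - t) *: (w + (y - u)).
  rewrite scalerDr [X in _ + X]scalerDr addrACA -/u -scalerDl.
  by rewrite [t + _]addrC subrK scale1r addrC subrK.
apply: convex_setW => //.
  by apply: yv; apply: affine_hull_direction => //; exact: hull.
by apply: yw; apply: affine_hull_direction => //; exact: hull.
Qed.

Lemma relint_segment A v k t b : convex_set A -> relint A v ->
  relint A (v + b *: k) -> 0 <= t <= b -> relint A (v + t *: k).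
Proof.
move=> cA Av Avk /andP[t0 tb].
have [b0|b0] := eqVneq b 0.
  suff -> : t = b by [].
  by apply/eqP; rewrite eq_le tb b0.
have bp : 0 < b by rewrite lt_neqAle eq_sym b0 (le_trans t0).
have -> : v + t *: k = (t / b) *: (v + b *: k) + (1 - t / b) *: v.
  rewrite scalerDr scalerA divfK// addrAC -scalerDl [t / b + _]addrC subrK.
  by rewrite scale1r.
by apply: relint_convex => //; rewrite divr_ge0 ?(ltW bp)//= ler_pdivrMr// mul1r.
Qed.

End AffineGeometry.

(** * Directional derivatives, along lines and under reversal of the direction *)

Section DirectionalDerivative.
Context {R : realType} {V : normedModType R}.
Implicit Types (F : V -> R) (v h : V) (t d : R).

(** The two difference quotients are the same function of the increment; this is how the
    one-variable estimates reach [F]. *)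
Lemma is_derive_line F v h t d : is_derive (v + t *: h) h F d ->
  is_derive t 1 (fun x : R => F (v + x *: h)) d.
Proof.
move=> [dF <-].
have E : (fun x : R => x^-1 *: (((fun y : R => F (v + y *: h)) \o shift t)
    (x *: (1 : R)) - F (v + t *: h))) =
  (fun x : R => x^-1 *: ((F \o shift (v + t *: h)) (x *: h) - F (v + t *: h))).
  apply/funext => x /=; congr (_ *: (F _ - _)).
  by rewrite [x%:A]mulr1 scalerDl addrCA.
by split; rewrite /derivable /derive E.
Qed.

Lemma is_derive_lineE F v h d : is_derive (0 : R) 1 (fun x : R => F (v + x *: h)) d ->
  is_derive v h F d.
Proof.
move=> [dF <-].
have E : (fun x : R => x^-1 *: (((fun y : R => F (v + y *: h)) \o shift 0)
    (x *: (1 : R)) - F (v + 0 *: h))) =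
  (fun x : R => x^-1 *: ((F \o shift v) (x *: h) - F v)).
  apply/funext => x /=; congr (_ *: (F _ - F _)).
    by rewrite [x%:A]mulr1 addr0 addrC.
  by rewrite scale0r addr0.
by move: dF; split; rewrite ?/derivable ?/derive -E.
Qed.

Lemma derive_junk F v h : ~ derivable F v h -> 'D_h F v = 0.
Proof. by move=> ndF; exact: dvgP. Qed.

(* Holds with no differentiability assumption: both sides have the same junk
   value when the limit does not exist. *)
Lemma derive_oppdir F v h : 'D_(- h) F v = - 'D_h F v.
Proof.
have half k : derivable F v k -> derivable F v (- k) /\ 'D_(- k) F v = - 'D_k F v.
  move=> dF.
  suff H : x^-1 *: ((F \o shift v) (x *: - k) - F v) @[x --> (0 : R)^'] --> - 'D_k F v.
    by split; [apply/cvg_ex; exists (- 'D_k F v)|exact/cvg_lim].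
  have opp0 : - x @[x --> (0 : R)^'] --> (0 : R)^'.
    rewrite -{2}oppr0 dnbhsN => A /= [B B0 <-].
    by apply: filterS B0 => x Bx /=; exists x.
  have E : (fun x : R => x^-1 *: ((F \o shift v) (x *: - k) - F v)) =
      (fun x : R => - ((- x)^-1 *: ((F \o shift v) (- x *: k) - F v))).
    by apply/funext => x; rewrite invrN !scaleNr opprK scalerN.
  rewrite E; apply: cvgN.
  exact: (cvg_comp (fun x : R => - x)
    (fun x : R => x^-1 *: ((F \o shift v) (x *: k) - F v)) opp0 dF).
have [dF|ndF] := pselect (derivable F v h); first by have [] := half _ dF.
rewrite (derive_junk ndF) oppr0; apply: derive_junk.
by move=> dF; apply: ndF; rewrite -(opprK h); exact: (half _ dF).1.
Qed.

Lemma deriveN_total F v h : 'D_h (\- F) v = - 'D_h F v.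
Proof.
have [dF|ndF] := pselect (derivable F v h); first exact: deriveN.
rewrite (derive_junk ndF) oppr0; apply: derive_junk => dF; apply: ndF.
by have := derivableN dF; rewrite opprK.
Qed.

Lemma derive2_oppdir F v h : 'D_(- h) ('D_(- h) F) v = 'D_h ('D_h F) v.
Proof.
have -> : 'D_(- h) F = \- 'D_h F by apply/funext => w; exact: derive_oppdir.
by rewrite derive_oppdir deriveN_total opprK.
Qed.

(** Odd order changes sign while even order does not: this makes the one-sided self-concordance
    inequality two-sided. *)
Lemma derive3_oppdir F v h :
  'D_(- h) ('D_(- h) ('D_(- h) F)) v = - 'D_h ('D_h ('D_h F)) v.
Proof.
have E : 'D_(- h) ('D_(- h) F) = 'D_h ('D_h F).
  by apply/funext => w; exact: derive2_oppdir.
exact: etrans (congr1 (fun g => 'D_(- h) g v) E) (derive_oppdir _ _ _).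
Qed.

End DirectionalDerivative.

(** * The pairing and orthogonal projection *)

Section Pairing.
Context {R : realType} {n m : nat}.
Local Notation E := 'M[R]_(n, m).
Implicit Types (v w f g : E) (a : R).

Lemma pairingC v f : pairing v f = pairing f v.
Proof. by apply: eq_bigr => i _; apply: eq_bigr => j _; rewrite mulrC. Qed.

Lemma pairingDl v w f : pairing (v + w) f = pairing v f + pairing w f.
Proof.
rewrite -big_split; apply: eq_bigr => i _; rewrite -big_split.
by apply: eq_bigr => j _; rewrite mxE mulrDl.
Qed.

Lemma pairingZl a v f : pairing (a *: v) f = a * pairing v f.
Proof.
rewrite mulr_sumr; apply: eq_bigr => i _; rewrite mulr_sumr.
by apply: eq_bigr => j _; rewrite mxE mulrA.
Qed.

Lemma pairingNl v f : pairing (- v) f = - pairing v f.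
Proof. by rewrite -scaleN1r pairingZl mulN1r. Qed.

Lemma pairingBl v w f : pairing (v - w) f = pairing v f - pairing w f.
Proof. by rewrite pairingDl pairingNl. Qed.

Lemma pairingDr f v w : pairing f (v + w) = pairing f v + pairing f w.
Proof. by rewrite !(pairingC f) pairingDl. Qed.

Lemma pairingZr a f v : pairing f (a *: v) = a * pairing f v.
Proof. by rewrite !(pairingC f) pairingZl. Qed.

Lemma pairingNr f v : pairing f (- v) = - pairing f v.
Proof. by rewrite !(pairingC f) pairingNl. Qed.

Lemma pairingBr f v w : pairing f (v - w) = pairing f v - pairing f w.
Proof. by rewrite !(pairingC f) pairingBl. Qed.

Lemma pairing0r f : pairing f 0 = 0.
Proof. by rewrite -(scale0r (0 : E)) pairingZr mul0r. Qed.

Lemma pairing_self_eq0 v : pairing v v = 0 -> v = 0.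
Proof.
move=> /eqP; rewrite psumr_eq0 => [/allP v0|i _]; last first.
  by apply: sumr_ge0 => j _; exact: sqr_ge0.
apply/matrixP => i j; rewrite mxE.
have := v0 i; rewrite mem_index_enum => /(_ isT) /=.
rewrite psumr_eq0 => [/allP/(_ j)|k _]; last exact: sqr_ge0.
by rewrite mem_index_enum => /(_ isT) /=; rewrite mulf_eq0 orbb => /eqP.
Qed.

Lemma pairing_le_norm v f : `|pairing v f| <= `|v| * \sum_i \sum_j `|f i j|.
Proof.
rewrite (le_trans (ler_norm_sum _ _ _))// mulr_sumr ler_sum// => i _.
rewrite (le_trans (ler_norm_sum _ _ _))// mulr_sumr ler_sum// => j _.
rewrite normrM ler_wpM2r//.
rewrite [leRHS]mx_normrE.
exact: (le_bigmax 0 (fun ij : 'I_n * 'I_m => `|v ij.1 ij.2|) (i, j)).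
Qed.

(** [D] is only a set closed under linear combinations. A subspace of [D] of maximal dimension among
    those admitting projections must contain [D]: the residual of a point outside would enlarge
    it. *)
Lemma orthogonal_projection (D : set E) v : D 0 ->
  (forall h k a, D h -> D k -> D (h + a *: k)) ->
  exists2 d, D d & forall k, D k -> pairing (v - d) k = 0.
Proof.
move=> D0 DDZ.
pose good (U : {vspace E}) := (forall u, u \in U -> D u) /\
  forall x, exists2 d, d \in U & forall k, k \in U -> pairing (x - d) k = 0.
pose P k := `[< exists2 U, good U & \dim U = k >].
have exP : exists k, P k.
  exists 0%N; apply/asboolP; exists 0%VS; last exact: dimv0.
  split=> [u|x]; first by rewrite memv0 => /eqP ->.
  exists 0; first exact: mem0v.
  by move=> k; rewrite memv0 => /eqP ->; exact: pairing0r.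
have ubP k : P k -> (k <= \dim {: E})%N.
  by move=> /asboolP[U _ <-]; exact/dimvS/subvf.
have [k /asboolP[U [UD Uproj] <-] kmax] := ex_maxnP exP ubP.
suff DU u : D u -> u \in U.
  by have [d dU dort] := Uproj v; exists d => [|h /DU]; [exact: UD|exact: dort].
move=> Du; have [d dU] := Uproj u.
have : D (u - d) by rewrite -scaleN1r; apply: DDZ => //; exact: UD.
move eE : (u - d) => e De dort.
have [e0|e0] := eqVneq e 0.
  by move/eqP: eE; rewrite e0 subr_eq0 => /eqP ->.
have ee0 : pairing e e != 0 by apply: contra_neq e0; exact: pairing_self_eq0.
have eU : e \notin U.
  by apply: contra_neqN ee0 => eU; exact: dort.
have : (\dim (U + <[e]>) <= \dim U)%N.
  apply: kmax; apply/asboolP; exists (U + <[e]>)%VS => //; split.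
    by move=> _ /memv_addP[x xU [_ /vlineP[a ->] ->]]; apply: DDZ => //; exact: UD.
  move=> x; have [c cU cort] := Uproj x.
  (* Gram-Schmidt: [e] is orthogonal to [U], so the projections on [U] and on the line of [e] add
     up. *)
  exists (c + (pairing x e / pairing e e) *: e).
    by apply: memv_add => //; exact/memvZ/memv_line.
  move=> _ /memv_addP[y yU [_ /vlineP[a ->] ->]].
  have ey0 : pairing e y = 0 by exact: dort.
  have ce0 : pairing c e = 0 by rewrite pairingC dort.
  have := cort _ yU; rewrite !(pairingBl, pairingDr, pairingDl, pairingZl, pairingZr).
  rewrite ey0 ce0 => xc; apply: etrans xc; field; exact: ee0.
move=> dimle; have /eqP UE : U == (U + <[e]>)%VS by rewrite eqEdim addvSl.
by case/negP: eU; rewrite UE; apply: (subvP (addvSr U <[e]>)); exact: memv_line.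
Qed.

End Pairing.

(** Were [s < d], the difference quotients at small positive [x] would exceed [s]. *)
Lemma derive_le_slope (R : realType) (g : R -> R) (d b s : R) : 0 < b ->
  is_derive (0 : R) 1 g d -> (forall x, 0 < x < b -> g x <= g 0 + x * s) -> d <= s.
Proof.
move=> b0 gd gs; rewrite leNgt; apply/negP => sd.
have [dg dgE] := gd.
have /cvgrPdist_lt/(_ (d - s)) : x^-1 *: ((g \o shift 0) (x *: (1 : R)) - g 0)
    @[x --> (0 : R)^'] --> d by rewrite -dgE; exact: dg.
rewrite subr_gt0 => /(_ sd) /nbhs_ballP[e /= e0] He.
pose x := Num.min (e / 2) (b / 2).
have x0 : 0 < x by rewrite lt_min !divr_gt0.
have xe : x < e.
  by rewrite gt_min [e / 2 < e]ltr_pdivrMr// ltr_pMr// ltr1n.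
have xb : x < b.
  by rewrite gt_min [b / 2 < b]ltr_pdivrMr// [b < b * 2]ltr_pMr// ltr1n orbT.
have := He x; rewrite /ball /= sub0r normrN gtr0_norm// gt_eqF// => /(_ xe isT).
rewrite [x%:A]mulr1 addr0 => /ltr_normlW; apply/negP; rewrite -leNgt lerD2l lerN2.
have /gs : 0 < x < b by rewrite x0.
by rewrite -lerBlDl /GRing.scale /= ler_pdivrMl// mulrC.
Qed.

(** * Tangent bounds, local norms and Dikin's ellipsoid for the barrier *)

Section LocalGeometry.
Context {R : realType} {n m : nat}.
Local Notation E := 'M[R]_(n, m).
Context (G : set E) (F : E -> R).
Context (G_closed : closed G) (G_convex : convex_set G) (hF : mirror_barrier G F).
Implicit Types (v w k h f : E) (a b t : R).
Local Notation relG := (relint G).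
Local Notation dirG := (direction G).

Local Lemma G_neq0 v : relG v -> G !=set0.
Proof. by move=> Gv; exists v; exact: relintW. Qed.

Lemma barrier_derivable v k : relG v -> dirG k ->
  [/\ derivable F v k, derivable ('D_k F) v k & derivable ('D_k ('D_k F)) v k].
Proof.
move=> Gv Gk; have [_ [_ + _] _ _ _] := hF.
move=> /(_ k Gk)[d1 /(_ k Gk)[d2 /(_ k Gk)[d3 _]]].
by split; [exact: d1|exact: d2|exact: d3].
Qed.

Lemma barrier_line v k b x : relG v -> dirG k -> relG (v + b *: k) ->
  0 <= x <= b ->
  [/\ is_derive x 1 (fun t : R => F (v + t *: k)) ('D_k F (v + x *: k)),
      is_derive x 1 (fun t : R => 'D_k F (v + t *: k)) ('D_k ('D_k F) (v + x *: k))
    & is_derive x 1 (fun t : R => 'D_k ('D_k F) (v + t *: k))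
        ('D_k ('D_k ('D_k F)) (v + x *: k))].
Proof.
move=> Gv Gk Gvk xb.
have Gx : relG (v + x *: k) by exact: relint_segment xb.
have [d1 d2 d3] := barrier_derivable Gx Gk.
by split; [exact: is_derive_line (derivableP d1)|exact: is_derive_line (derivableP d2)
  |exact: is_derive_line (derivableP d3)].
Qed.

(** Convexity puts [F] below its chord on the segment, and the slope at [v] is at most that of the
    chord. Negative [t] reduces to direction [- k]. *)
Lemma barrier_tangent v k t : relG v -> dirG k -> relG (v + t *: k) ->
  F v + t * 'D_k F v <= F (v + t *: k).
Proof.
wlog t0 : t k / 0 < t => [pos|] Gv Gk Gvk.
  have [t0|t0|->] := ltgtP t 0; last by rewrite mul0r addr0 scale0r addr0.
  - have := pos (- t) (- k); rewrite oppr_gt0 => /(_ t0 Gv).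
    rewrite scaleNr scalerN opprK derive_oppdir mulrNN; apply => //.
    by apply: directionN => //; exact: G_neq0 Gv.
  - exact: pos.
have [_ _ [scF _] _ _] := hF.
have [d1 _ _] := @barrier_line v k t 0 Gv Gk Gvk (introT andP (conj (lexx 0) (ltW t0))).
rewrite scale0r addr0 in d1.
rewrite -lerBrDl -ler_pdivlMl//; apply: (derive_le_slope t0 d1) => x /andP[x0 xt].
rewrite scale0r addr0.
have [k0|k0] := eqVneq k 0.
  by rewrite k0 !scaler0 !addr0 subrr !mulr0 addr0.
have xt1 : x / t < 1 by rewrite ltr_pdivrMr// mul1r.
have := scF (v + t *: k) v (x / t) Gvk Gv _ (divr_gt0 x0 t0) xt1.
have -> : (x / t) *: (v + t *: k) + (1 - x / t) *: v = v + x *: k.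
  rewrite scalerDr scalerA divfK ?gt_eqF// addrAC -scalerDl [x / t + _]addrC.
  by rewrite subrK scale1r.
rewrite -subr_eq0 addrAC subrr add0r scaler_eq0 negb_or gt_eqF// k0 => /(_ isT).
move=> /ltW/le_trans; apply; rewrite le_eqVlt; apply/orP; left; apply/eqP; field.
by rewrite gt_eqF.
Qed.

(** Adding the tangent inequalities at [v] and at [v + x *: k] shows that ['D_k F] increases along
    [k]. *)
Lemma barrier_derive2_ge0 v k : relG v -> dirG k -> 0 <= 'D_k ('D_k F) v.
Proof.
move=> Gv Gk.
have /nbhs_ballP[e /= e0 He] := near_relint_line Gv Gk.
have d2 : is_derive (0 : R) 1 (fun t : R => - 'D_k F (v + t *: k)) (- 'D_k ('D_k F) v).
  have Gv0 : relG (v + 0 *: k) by rewrite scale0r addr0.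
  have [_ + _] := @barrier_line v k 0 0 Gv Gk Gv0 (introT andP (conj (lexx 0) (lexx 0))).
  rewrite scale0r addr0 => ?; exact: is_deriveN.
rewrite -oppr_le0; apply: (derive_le_slope e0 d2) => x /andP[x0 xe].
have Gx : relG (v + x *: k).
  by apply: He; rewrite /ball /= sub0r normrN gtr0_norm.
rewrite mulr0 addr0 scale0r addr0 lerN2.
have t1 := barrier_tangent Gv Gk Gx.
have Gx' : relG (v + x *: k + - x *: k) by rewrite scaleNr addrK.
have := barrier_tangent Gx Gk Gx'; rewrite scaleNr addrK => t2.
by rewrite -(ler_pM2l x0); lra.
Qed.

Definition local_norm v k : R := Num.sqrt ('D_k ('D_k F) v).

Lemma local_norm_ge0 v k : 0 <= local_norm v k.
Proof. exact: sqrtr_ge0. Qed.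

Lemma local_normN v k : local_norm v (- k) = local_norm v k.
Proof.
by rewrite /local_norm derive2_oppdir.
Qed.

(** The definition bounds the third derivative from above only; the lower bound is the same
    inequality along [- k]. *)
Lemma barrier_self_concordant v k : relG v -> dirG k ->
  `|'D_k ('D_k ('D_k F)) v| <=
    2 * ('D_k ('D_k F) v * Num.sqrt ('D_k ('D_k F) v)).
Proof.
move=> Gv Gk; have [_ [_ _ sc] _ _ _] := hF.
have Gk' : dirG (- k) by apply: directionN => //; exact: G_neq0 Gv.
have p0 := barrier_derive2_ge0 Gv Gk.
have powE (p : R) : 0 <= p -> p `^ (3 / 2) = p * Num.sqrt p.
  move=> p_ge0; have -> : 3 / 2 = 1 + 2^-1 :> R by field.
  rewrite powRD; first by rewrite powRr1// powR12_sqrt.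
  by apply/implyP => /eqP; lra.
rewrite ler_norml -powE// sc// andbT lerNl.
have sc_le (a b : R) : 'D_(- k) ('D_(- k) ('D_(- k) F)) v = a ->
    'D_(- k) ('D_(- k) F) v = b -> a <= 2 * b `^ (3 / 2).
  by move=> <- <-; exact: sc.
exact: sc_le (derive3_oppdir F v k) (derive2_oppdir F v k).
Qed.

Lemma barrier_lower v k : relG v -> dirG k -> relG (v + k) ->
  F v + 'D_k F v + local_norm v k ^+ 2 / (2 * (1 + local_norm v k)) <= F (v + k).
Proof.
move=> Gv Gk Gvk; have Gvk1 : relG (v + 1 *: k) by rewrite scale1r.
have L x (x01 : 0 <= x <= 1) := barrier_line Gv Gk Gvk1 x01.
have := @self_concordant_lower R (fun t => F (v + t *: k))
  (fun t => 'D_k F (v + t *: k)) (fun t => 'D_k ('D_k F) (v + t *: k))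
  (fun t => 'D_k ('D_k ('D_k F)) (v + t *: k)) 1 ler01.
rewrite scale0r addr0 scale1r !mulr1 -/(local_norm v k); apply.
- by move=> x xb; case: (L x xb) => H _ _; exact: H.
- by move=> x xb; case: (L x xb) => _ H _; exact: H.
- by move=> x xb; case: (L x xb) => _ _ H; exact: H.
- by move=> x x01; apply: barrier_derive2_ge0 => //; exact: relint_segment x01.
- by move=> x x01; apply: barrier_self_concordant => //; exact: relint_segment x01.
Qed.

(** The endpoint is assumed interior here because [dikin] relies on this estimate; [barrier_upper]
    then drops the assumption. *)
Local Lemma barrier_upper_relint v k b : relG v -> dirG k -> 0 <= b ->
  relG (v + b *: k) -> local_norm v k * b < 1 ->
  F (v + b *: k) <= F v + 'D_k F v * b +
    (local_norm v k * b) ^+ 2 / (2 * (1 - local_norm v k * b) ^+ 2).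
Proof.
move=> Gv Gk b0 Gvk rb1.
have L x (xb : 0 <= x <= b) := barrier_line Gv Gk Gvk xb.
have := @self_concordant_upper R (fun t => F (v + t *: k))
  (fun t => 'D_k F (v + t *: k)) (fun t => 'D_k ('D_k F) (v + t *: k))
  (fun t => 'D_k ('D_k ('D_k F)) (v + t *: k)) b b0.
rewrite scale0r addr0 -/(local_norm v k); apply; last exact: rb1.
- by move=> x xb; case: (L x xb) => H _ _; exact: H.
- by move=> x xb; case: (L x xb) => _ H _; exact: H.
- by move=> x xb; case: (L x xb) => _ _ H; exact: H.
- by move=> x x01; apply: barrier_derive2_ge0 => //; exact: relint_segment x01.
- by move=> x x01; apply: barrier_self_concordant => //; exact: relint_segment x01.
Qed.

(* Dikin's ellipsoid: up to the exit point of the ray, F stays bounded, which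
   contradicts the barrier property. *)
Lemma dikin v k b : relG v -> dirG k -> 0 <= b -> local_norm v k * b < 1 ->
  relG (v + b *: k).
Proof.
move=> Gv Gk b0 rb1; apply: contrapT => nGb.
have r0 := local_norm_ge0 v k; set r := local_norm v k in rb1 r0.
pose S := [set t : R | 0 <= t <= b /\ relG (v + t *: k)].
have S0 : S 0 by split; [rewrite lexx|rewrite scale0r addr0].
have Sub : ubound S b by move=> t [/andP[]].
have supS : has_sup S by split; [exists 0|exists b].
pose c := sup S.
have c_ge0 : 0 <= c by exact: (ub_le_sup supS.2).
have c_le : c <= b by apply: ge_sup => //; exists 0.
have Slt t : 0 <= t -> t < c -> relG (v + t *: k).
  move=> t0 tc; have [s [_ Gs] ts] := sup_gt supS.1 tc.
  by apply: (relint_segment G_convex Gv Gs); rewrite t0 ltW.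
(* From an interior exit point the ray could be continued a little, against the supremum; [c < b]
   because the point at [b] is outside. *)
have nGc : ~ relG (v + c *: k).
  move=> Gc; have /nbhs_ballP[e /= e0 He] := near_relint_line Gc Gk.
  have cb : c < b.
    by rewrite lt_neqAle c_le andbT; apply/eqP => cb; apply: nGb; rewrite -cb.
  pose t := Num.min (e / 2) (b - c).
  have t0 : 0 < t by rewrite lt_min divr_gt0 ?subr_gt0.
  have te : t < e by rewrite gt_min [e / 2 < e]ltr_pdivrMr// ltr_pMr// ltr1n.
  have : S (c + t).
    split.
      by rewrite addr_ge0 ?(ltW t0)//= -lerBrDl ge_min lexx orbT.
    rewrite scalerDl addrA; apply: He.
    by rewrite /ball /= sub0r normrN gtr0_norm.
  by move=> /(ub_le_sup supS.2); apply/negP; rewrite -ltNge ltrDl.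
have c0 : 0 < c.
  rewrite lt_neqAle c_ge0 andbT; apply/eqP => c0; apply: nGc.
  by rewrite -c0 scale0r addr0.
(* Parameters strictly below [c] converging to it: interior points tending to the exit point. *)
pose T i := c * (1 - i.+1%:R^-1).
have T0 i : 0 <= T i.
  by rewrite mulr_ge0// subr_ge0 invf_le1// ler1n.
have Tc i : T i < c by rewrite gtr_pMr// ltrBlDr ltrDl invr_gt0.
have cvT : T i @[i --> \oo] --> c.
  have : T i @[i --> \oo] --> c * (1 - 0).
    apply: cvgM; first exact: cvg_cst.
    by apply: cvgB; [exact: cvg_cst|exact: cvg_harmonic].
  by rewrite subr0 mulr1.
have cvu : v + T i *: k @[i --> \oo] --> v + c *: k.
  by apply: cvgD; [exact: cvg_cst|apply: cvgZr_tmp].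
have Gu i : relG (v + T i *: k) by exact: Slt.
have [barF _ _ _ _] := hF.
have Gp : (closure G `\` relG) (v + c *: k).
  split=> //; apply: subset_closure.
  apply: (closed_cvg (F := \oo) (u_ := fun i => v + T i *: k) _ G_closed) cvu.
  by apply: nearW => i; exact: relintW.
(* The upper estimate at parameter [b] dominates the one at every [T i], so [F] stays below [M]
   along the sequence. *)
pose M := F v + `|'D_k F v| * b + (r * b) ^+ 2 / (2 * (1 - r * b) ^+ 2).
have := barF _ _ Gu Gp cvu; move=> /cvgryPge/(_ (M + 1))[N _ /(_ N (leqnn N))] /=.
apply/negP; rewrite -ltNge.
have Tb : T N <= b by exact/ltW/(lt_le_trans (Tc N)).
have rT : r * T N <= r * b by exact: ler_wpM2l.
have rT1 : r * T N < 1 by exact: le_lt_trans rb1.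
have := barrier_upper_relint Gv Gk (T0 N) (Gu N) rT1; rewrite -/r => up.
have s0 : 0 < 1 - r * b by rewrite subr_gt0.
have h2 : (r * T N) ^+ 2 / (2 * (1 - r * T N) ^+ 2) <=
    (r * b) ^+ 2 / (2 * (1 - r * b) ^+ 2).
  apply: ler_pM.
  - exact: sqr_ge0.
  - by rewrite invr_ge0 mulr_ge0// sqr_ge0.
  - by rewrite ler_pXn2r// nnegrE mulr_ge0.
  - rewrite lef_pV2 ?posrE ?mulr_gt0 ?exprn_gt0 ?subr_gt0//.
    by rewrite ler_pM2l// ler_pXn2r ?nnegrE ?subr_ge0 ?(ltW rb1) ?(ltW rT1)// lerD2l lerN2.
have h1 : 'D_k F v * T N <= `|'D_k F v| * b.
  apply: (le_trans (ler_norm _)); rewrite normrM (ger0_norm (T0 N)).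
  exact: ler_wpM2l.
by rewrite /M; lra.
Qed.

Lemma barrier_upper v k b : relG v -> dirG k -> 0 <= b ->
  local_norm v k * b < 1 ->
  F (v + b *: k) <= F v + 'D_k F v * b +
    (local_norm v k * b) ^+ 2 / (2 * (1 - local_norm v k * b) ^+ 2).
Proof.
by move=> Gv Gk b0 rb; apply: barrier_upper_relint => //; exact: dikin.
Qed.

End LocalGeometry.

(** * Scalar estimates dualising the local bounds, and second derivatives of convex functions *)

Lemma conj_local_upper (R : realType) (a r : R) : 0 <= a -> a <= 1 / 4 -> 0 <= r ->
  a * r - r ^+ 2 / (2 * (1 + r)) <= a ^+ 2 / 2 + 2 * a ^+ 3.
Proof.
move=> a0 a4 r0; have r1 : 0 < 1 + r by rewrite ltr_pwDl.
rewrite lerBlDr -lerBlDl ler_pdivlMr ?mulr_gt0//.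
pose c := 1 - 2 * a; have c0 : 0 < c by rewrite /c; lra.
(* after multiplication by [c] this is a square plus nonnegative terms *)
rewrite -(ler_pM2l c0) -subr_ge0.
have -> : c * r ^+ 2 - c * ((a * r - (a ^+ 2 / 2 + 2 * a ^+ 3)) * (2 * (1 + r))) =
    (c * r - a) ^+ 2 + a ^+ 2 * r + 2 * a ^+ 3 * (1 - 4 * a) * (1 + r).
  by rewrite /c; field.
have a3 : 0 <= 2 * a ^+ 3 by apply: mulr_ge0 => //; exact: exprn_ge0.
apply: addr_ge0.
  by apply: addr_ge0; [|apply: mulr_ge0 => //]; exact: sqr_ge0.
by apply: mulr_ge0; [apply: mulr_ge0 => //; lra|exact: ltW].
Qed.

(** The same conjugate as in [conj_local_upper], where the exact term [a ^+ 2 / 2] serves to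
    identify the Hessian. Here the range goes up to 1/2, beyond which the supremum over [r] is
    infinite; this gives the constant 2 of the regret bound. *)
Lemma conj_local_bound (R : realType) (a r : R) : 0 <= a -> a <= 1 / 2 -> 0 <= r ->
  a * r - r ^+ 2 / (2 * (1 + r)) <= 2 * a ^+ 2.
Proof.
move=> a0 a2 r0; have r1 : 0 < 1 + r by rewrite ltr_pwDl.
rewrite lerBlDr -lerBlDl ler_pdivlMr ?mulr_gt0// -subr_ge0.
have -> : r ^+ 2 - (a * r - 2 * a ^+ 2) * (2 * (1 + r)) =
    (1 - 2 * a) * (r - a) ^+ 2 + a ^+ 2 * (3 + 2 * a) by ring.
have s1 : 0 <= (r - a) ^+ 2 by exact: sqr_ge0.
have s2 : 0 <= a ^+ 2 by exact: sqr_ge0.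
by apply: addr_ge0; apply: mulr_ge0 => //; lra.
Qed.

(** Net gain of a test step of local length [x]: linear gain [x ^+ 2] minus the upper estimate on
    the growth of [F]. *)
Lemma conj_local_lower (R : realType) (x : R) : 0 <= x -> x <= 1 / 4 ->
  x ^+ 2 * (1 / 2 - 2 * x) <= x ^+ 2 - x ^+ 2 / (2 * (1 - x) ^+ 2).
Proof.
move=> x0 x4; have x1 : 0 < 1 - x by lra.
rewrite -{2}[x ^+ 2]mulr1 -mulrBr; apply: ler_wpM2l; first exact: sqr_ge0.
rewrite lerBrDr -lerBrDl -[_^-1]mul1r ler_pdivrMr ?mulr_gt0 ?exprn_gt0//.
rewrite -subr_ge0.
have -> : (1 - (1 / 2 - 2 * x)) * (2 * (1 - x) ^+ 2) - 1 =
    x * ((1 - 4 * x) * (2 - x) + 2 * x) by field.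
by apply: mulr_ge0 => //; apply: addr_ge0; apply: mulr_ge0; lra.
Qed.

(* For a convex function a second-order expansion forces the derivative to be
   differentiable: compare the subgradients [d s] with the increments of [psi]
   between [s] and [(1 + th) s], [(1 - th) s]. *)
Lemma convex_taylor2 (R : realType) (psi d : R -> R) (L : R) : 0 <= L ->
  (forall s, `|s| * L <= 1 / 8 ->
     `|psi s - (`|s| * L) ^+ 2 / 2| <= 2 * (`|s| * L) ^+ 3) ->
  (forall s s', psi s + (s' - s) * d s <= psi s') ->
  s^-1 * d s @[s --> 0^'] --> L ^+ 2.
Proof.
move=> L0 psiE psi_sub; apply/cvgrPdist_lt => e e0.
(* [th] makes the quadratic error [th / 2 * L ^+ 2] at most [e / 2]. *)
pose th := Num.min 1 (e / (L ^+ 2 + 1)).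
have L20 : 0 <= L ^+ 2 by exact: sqr_ge0.
have L30 : 0 <= L ^+ 3 by exact: exprn_ge0.
have L21 : 0 < L ^+ 2 + 1 by rewrite ltr_wpDl.
have th0 : 0 < th by rewrite lt_min ltr01 divr_gt0.
have th1 : th <= 1 by rewrite ge_min lexx.
have th3 : (1 + th) ^+ 3 <= 8.
  have -> : 8 = 2 ^+ 3 :> R by rewrite -natrX.
  by rewrite ler_pXn2r ?nnegrE//; lra.
have th3' : (1 - th) ^+ 3 <= 1 by rewrite exprn_ile1//; lra.
have the : th * (L ^+ 2 + 1) <= e by rewrite -ler_pdivlMr// ge_min lexx orbT.
(* The first term keeps [2 * s] within the radius 1/8 of the expansion; the second makes the cubic
   error at most [e / 4], with 72 = 4 * 18. *)
pose del := Num.min (1 / (16 * (L + 1))) (th * e / (72 * (L ^+ 3 + 1))).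
have L1 : 0 < L + 1 by rewrite ltr_wpDl.
have L31 : 0 < L ^+ 3 + 1 by rewrite ltr_wpDl.
have del0 : 0 < del by rewrite lt_min !divr_gt0 ?mulr_gt0.
near=> s.
have sdel : `|s| < del.
  near: s; apply: nbhs_dnbhs; apply/nbhs_ballP; exists del => //= x.
  by rewrite /ball /= sub0r normrN.
have s0 : s != 0 by near: s; exact: nbhs_dnbhs_neq.
set x := `|s| in sdel; have x0 : 0 < x by rewrite normr_gt0.
have [xd1 xd2] : x * (16 * (L + 1)) <= 1 /\ x * (72 * (L ^+ 3 + 1)) <= th * e.
  by rewrite -!ler_pdivlMr ?mulr_gt0//; move/ltW: sdel; rewrite le_min => /andP[].
have a1 : x * L <= 1 / 16 by nra.
have xL0 : 0 <= x * L by rewrite mulr_ge0// ltW.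
have bnd c : 0 <= c -> c <= 2 -> `|psi (c * s) - c ^+ 2 * (x * L) ^+ 2 / 2| <=
    2 * c ^+ 3 * (x * L) ^+ 3.
  move=> c0 c2; have := psiE (c * s); rewrite normrM (ger0_norm c0) -/x.
  have -> : c ^+ 2 * (x * L) ^+ 2 / 2 = (c * x * L) ^+ 2 / 2 by field.
  have -> : 2 * c ^+ 3 * (x * L) ^+ 3 = 2 * (c * x * L) ^+ 3 by ring.
  by apply; rewrite -mulrA; nra.
have : `|psi (1 * s) - 1 ^+ 2 * (x * L) ^+ 2 / 2| <= 2 * 1 ^+ 3 * (x * L) ^+ 3.
  by apply: bnd; lra.
rewrite mul1r ler_norml => /andP[lo1 hi1].
have : `|psi ((1 + th) * s) - (1 + th) ^+ 2 * (x * L) ^+ 2 / 2| <=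
    2 * (1 + th) ^+ 3 * (x * L) ^+ 3 by apply: bnd; lra.
rewrite ler_norml => /andP[_ hi2].
have : `|psi ((1 - th) * s) - (1 - th) ^+ 2 * (x * L) ^+ 2 / 2| <=
    2 * (1 - th) ^+ 3 * (x * L) ^+ 3 by apply: bnd; lra.
rewrite ler_norml => /andP[_ hi3].
have := psi_sub s ((1 + th) * s); have := psi_sub s ((1 - th) * s).
have -> : (1 - th) * s - s = - (th * s) by ring.
have -> : (1 + th) * s - s = th * s by ring.
move=> sub2 sub1.
have A30 : 0 <= (x * L) ^+ 3 by exact: exprn_ge0.
have A20 : 0 <= (x * L) ^+ 2 by exact: sqr_ge0.
(* The 18 is 2 * 8 from the cubic error at [(1 + th) * s], plus 2 from the one at [s]. *)
have up : th * (s * d s) <= (th + th ^+ 2 / 2) * (x * L) ^+ 2 + 18 * (x * L) ^+ 3.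
  have : (1 + th) ^+ 3 * (x * L) ^+ 3 <= 8 * (x * L) ^+ 3 by exact: ler_wpM2r.
  by lra.
have lo : (th - th ^+ 2 / 2) * (x * L) ^+ 2 - 18 * (x * L) ^+ 3 <= th * (s * d s).
  have : (1 - th) ^+ 3 * (x * L) ^+ 3 <= 1 * (x * L) ^+ 3 by exact: ler_wpM2r.
  by lra.
have sx : s * s = x * x by rewrite -!expr2 real_normK// num_real.
pose q := s^-1 * d s.
have qE : s * d s = x * x * q by rewrite -sx /q; field.
have tx : 0 < th * (x * x) by rewrite !mulr_gt0.
have dist : `|L ^+ 2 - q| <= th / 2 * L ^+ 2 + 18 * x * L ^+ 3 / th.
  rewrite -(ler_pM2l tx) -[X in X * `|_|](gtr0_norm tx) -normrM.
  have -> : th * (x * x) * (th / 2 * L ^+ 2 + 18 * x * L ^+ 3 / th) =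
     th ^+ 2 / 2 * (x * L) ^+ 2 + 18 * (x * L) ^+ 3 by field; rewrite gt_eqF.
  have -> : th * (x * x) * (L ^+ 2 - q) = th * (x * L) ^+ 2 - th * (s * d s).
    by rewrite qE; ring.
  by rewrite ler_norml; apply/andP; split; lra.
apply: (le_lt_trans dist).
have b1 : 18 * x * L ^+ 3 / th <= e / 4.
  by rewrite ler_pdivrMr//; nra.
by nra.
Unshelve. all: by end_near.
Qed.

(** * The conjugate, its gradient and its Hessian *)

Section Duality.
Context {R : realType} {n m : nat}.
Local Notation E := 'M[R]_(n, m).
Context (G : set E) (F : E -> R).
Context (G_closed : closed G) (G_convex : convex_set G) (hF : mirror_barrier G F).
Context (G_bounded : forall f : E, exists B, forall v, G v -> `|pairing v f| <= B).
Context (G_not0 : ~ G 0).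
Implicit Types (v w k h f y : E) (a b t s : R).
Local Notation relG := (relint G).
Local Notation dirG := (direction G).
Local Notation Fstar := (conjugate G F).

(* [gradient] defaults to 0 where F has no gradient; by injectivity it takes the
   value 0 only at the minimiser of F, where 0 is a genuine gradient. *)
Lemma gradientP v : relG v ->
  dirG (gradient G F v) /\ forall k, dirG k -> 'D_k F v = pairing (gradient G F v) k.
Proof.
have [_ _ _ [[_ ginj _] _ _] [[v1 Gv1 Fv1] F_ge0]] := hF.
pose P w g := dirG g /\ forall k, dirG k -> is_derive w k F (pairing g k).
have xgetP0 w : (exists g, P w g) -> P w (gradient G F w) by exact: xgetPex.
have genuine w : gradient G F w <> 0 -> P w (gradient G F w).
  move=> gw; have [/xgetP0//|nex] := pselect (exists g, P w g).
  by case: gw; apply: xgetPN => g Pg; apply: nex; exists g.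
have G0 : G !=set0 by exists v1; exact: relintW.
have slope0 k : dirG k -> 0 <= 'D_k F v1.
  move=> Gk; have /nbhs_ballP[e /= e0 He] := near_relint_line Gv1 Gk.
  have Gv10 : relG (v1 + 0 *: k) by rewrite scale0r addr0.
  have [d1 _ _] := barrier_line G_convex hF Gv1 Gk Gv10
    (introT andP (conj (lexx 0) (lexx 0))).
  rewrite scale0r addr0 in d1.
  have d1' : is_derive (0 : R) 1 (fun t : R => - F (v1 + t *: k)) (- 'D_k F v1).
    exact: is_deriveN.
  rewrite -oppr_le0; apply: (derive_le_slope e0 d1') => x /andP[x0 xe].
  rewrite mulr0 addr0 scale0r addr0 lerN2 Fv1; apply: F_ge0.
  by apply: He; rewrite /ball /= sub0r normrN gtr0_norm.
have D0 k : dirG k -> 'D_k F v1 = 0.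
  move=> Gk; apply/eqP; rewrite eq_le slope0// andbT -oppr_ge0 -derive_oppdir.
  by apply: slope0; exact: directionN.
have P1 : P v1 0.
  split=> [|k Gk]; first exact: direction0.
  rewrite pairingC pairing0r -(D0 k Gk); apply: derivableP.
  by have [] := barrier_derivable hF Gv1 Gk.
have Pg1 : P v1 (gradient G F v1) by apply: xgetP0; exists 0.
have g10 : gradient G F v1 = 0.
  by apply: pairing_self_eq0; rewrite -(D0 _ Pg1.1); have [_ ->] := Pg1.2 _ Pg1.1.
move=> Gv; have [dg dF] : P v (gradient G F v).
  have [gv0|/genuine//] := pselect (gradient G F v = 0).
  by rewrite (ginj v v1 (mem_set Gv) (mem_set Gv1) (etrans gv0 (esym g10))).
by split=> // k /dF[].
Qed.

Lemma gradient_tangent v w : relG v -> relG w ->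
  F v + pairing (gradient G F v) (w - v) <= F w.
Proof.
move=> Gv Gw; have Gk : dirG (w - v) by apply: directionB; exact: relintW.
have := barrier_tangent G_convex hF (t := 1) Gv Gk.
by rewrite mul1r scale1r addrC subrK (gradientP Gv).2// => /(_ Gw).
Qed.

Lemma gradient_lower v w : relG v -> relG w ->
  F v + pairing (gradient G F v) (w - v) +
    local_norm F v (w - v) ^+ 2 / (2 * (1 + local_norm F v (w - v))) <= F w.
Proof.
move=> Gv Gw; have Gk : dirG (w - v) by apply: directionB; exact: relintW.
have := barrier_lower G_convex hF Gv Gk.
by rewrite addrC subrK (gradientP Gv).2// => /(_ Gw).
Qed.

(** Dikin's ellipsoid lies in the bounded set [G], where [pairing _ f] varies by at most [2 * B]. So
    the dual norm below is finite, and [f] vanishes on directions of local norm 0. *)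
Lemma pairing_le_local_norm f : exists C, forall v k, relG v -> dirG k ->
  `|pairing f k| <= C * local_norm F v k.
Proof.
have [B0 HB0] := G_bounded f; pose B := Num.max B0 0.
have B_ge0 : 0 <= B by rewrite le_max lexx orbT.
have HB v : relG v -> `|pairing v f| <= B.
  by move=> /relintW/HB0 vB; rewrite le_max vB.
exists (2 * B) => v k Gv Gk.
have r0 := local_norm_ge0 F v k; set r := local_norm F v k in r0 *.
(* Dividing by [r + e] gives a step strictly inside the ellipsoid, even when [r = 0]. *)
have key e : 0 < e -> `|pairing f k| <= 2 * B * (r + e).
  move=> e0; have re : 0 < r + e by rewrite ltr_wpDl.
  have b0 : 0 <= (r + e)^-1 by rewrite invr_ge0 ltW.
  have rb : r * (r + e)^-1 < 1 by rewrite ltr_pdivrMr// mul1r ltrDl.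
  have Gb := dikin G_closed G_convex hF Gv Gk b0 rb.
  rewrite -ler_pdivrMr// -{1}[r + e]gtr0_norm// -normfV -normrM.
  have -> : pairing f k / (r + e) = pairing (v + (r + e)^-1 *: k) f - pairing v f.
    by rewrite pairingDl pairingZl addrAC subrr add0r pairingC mulrC.
  apply: (le_trans (ler_normB _ _)); rewrite mulr_natl mulr2n.
  by apply: lerD; exact: HB.
apply/ler_addgt0Pr => e e0.
have B1 : 0 < 2 * B + 1 by rewrite ltr_wpDl// mulr_ge0.
apply: (le_trans (key (e / (2 * B + 1)) _)); first by rewrite divr_gt0.
rewrite mulrDr lerD2l mulrCA -[leRHS]mulr1 ler_pM2l//.
by rewrite ler_pdivrMr// mul1r lerDl.
Qed.

(** Directions of local norm 0 contribute 0 through division by zero, which is harmless since [f]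
    vanishes on them. *)
Definition dual_local_norm v f : R :=
  sup [set `|pairing f k| / local_norm F v k | k in dirG].

Local Lemma has_sup_dual v f : relG v ->
  has_sup [set `|pairing f k| / local_norm F v k | k in dirG].
Proof.
move=> Gv; split.
  exists (`|pairing f 0| / local_norm F v 0), 0 => //.
  by apply: direction0; exists v; exact: relintW.
have [C HC] := pairing_le_local_norm f; exists (Num.max C 0) => _ [k Gk <-].
have /orP[/eqP <-|r0] : (0 == local_norm F v k) || (0 < local_norm F v k).
  by rewrite -le_eqVlt; exact: local_norm_ge0.
  by rewrite invr0 mulr0 le_max lexx orbT.
by rewrite ler_pdivrMr// (le_trans (HC _ _ Gv Gk))// ler_pM2r// le_max lexx.
Qed.

Lemma dual_local_norm_ge v f k : relG v -> dirG k ->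
  `|pairing f k| / local_norm F v k <= dual_local_norm v f.
Proof.
by move=> Gv Gk; apply: (ub_le_sup (has_sup_dual f Gv).2); exists k.
Qed.

Lemma dual_local_norm_ge0 v f : relG v -> 0 <= dual_local_norm v f.
Proof.
move=> Gv; have Gk : dirG 0 by apply: direction0; exists v; exact: relintW.
apply: le_trans (dual_local_norm_ge f Gv Gk).
by rewrite divr_ge0// local_norm_ge0.
Qed.

Lemma pairing_le_dual v f k : relG v -> dirG k ->
  `|pairing f k| <= dual_local_norm v f * local_norm F v k.
Proof.
move=> Gv Gk.
have /orP[/eqP r0|r0] : (0 == local_norm F v k) || (0 < local_norm F v k).
  by rewrite -le_eqVlt; exact: local_norm_ge0.
  have [C /(_ v k Gv Gk)] := pairing_le_local_norm f.
  by rewrite -r0 !mulr0.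
by rewrite -ler_pdivrMr//; exact: dual_local_norm_ge.
Qed.

(* [y] need not lie in [dirG]: only its restriction to [dirG] matters. *)
Definition dual_point y w : Prop :=
  relG w /\ forall k, dirG k -> pairing y k = pairing (gradient G F w) k.

(** Surjectivity of the gradient applies to the projection of [y] on [dirG]; the orthogonal
    remainder does not act on [dirG]. *)
Lemma dual_point_ex y : relG !=set0 -> exists w, dual_point y w.
Proof.
move=> [v Gv]; have G0 : G !=set0 by exists v; exact: relintW.
have [d Gd dort] := orthogonal_projection y (direction0 G0) (@directionDZ _ _ G).
have [_ _ _ [[_ _ gsurj] _ _] _] := hF.
have [w Gw wd] := gsurj _ Gd.
exists w; split=> // k Gk; rewrite wd; apply/eqP.
by rewrite -subr_eq0 -pairingBl dort.
Qed.

Lemma dual_point_gradient v : relG v -> dual_point (gradient G F v) v.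
Proof. by []. Qed.

Lemma dual_point_max y w v : dual_point y w -> relG v ->
  pairing y v - F v <= pairing y w - F w.
Proof.
move=> [Gw yw] Gv; have := gradient_tangent Gw Gv.
rewrite -yw; last by apply: directionB; exact: relintW.
by rewrite pairingBr; lra.
Qed.

Lemma conjugateE y w : dual_point y w -> Fstar y = pairing y w - F w.
Proof.
move=> yw; have ub : ubound [set pairing y v - F v | v in relG] (pairing y w - F w).
  by move=> _ [v Gv <-]; exact: dual_point_max.
have mem : [set pairing y v - F v | v in relG] (pairing y w - F w).
  by exists w => //; exact: yw.1.
apply/eqP; rewrite eq_le; apply/andP; split.
  by apply: ge_sup => //; exists (pairing y w - F w).
by apply: ub_le_sup => //; exists (pairing y w - F w).
Qed.

Lemma fenchel_young y v : relG v -> pairing y v - F v <= Fstar y.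
Proof.
move=> Gv; have [w yw] := dual_point_ex y (ex_intro _ v Gv).
by rewrite (conjugateE yw); exact: dual_point_max.
Qed.

(** [y - gradient G F w] is orthogonal to [dirG], hence constant on [relG]. This carries facts about
    the conjugate from gradients to arbitrary [y]. *)
Lemma conjugate_shift y w x : dual_point y w ->
  Fstar (x + (y - gradient G F w)) = Fstar x + pairing (y - gradient G F w) w.
Proof.
move=> [Gw yw]; set c := y - _.
have cort k : dirG k -> pairing c k = 0 by move=> /yw; rewrite pairingBl => ->; rewrite subrr.
have [u xu] := dual_point_ex x (ex_intro _ w Gw); have [Gu xuE] := xu.
have xcu : dual_point (x + c) u.
  by split=> // k Gk; rewrite pairingDl cort// addr0 xuE.
rewrite (conjugateE xu) (conjugateE xcu) pairingDl addrAC; congr (_ + _).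
by apply/eqP; rewrite -subr_eq0 -pairingBr cort//; apply: directionB; exact: relintW.
Qed.

(* The default value 0 of [conj_gradient] is ruled out because 0 is not in G. *)
Lemma is_derive_conjugate y w k : dual_point y w -> is_derive y k Fstar (pairing w k).
Proof.
move=> yw; have [Gw _] := yw; set h := gradient G F w.
have hw : is_derive h k Fstar (pairing w k).
  have [_ _ _ [_ /(_ w Gw) cg _] _] := hF.
  pose P := [set g | [set: E] g /\ forall k, [set: E] k -> is_derive h k Fstar (pairing g k)].
  have cgE : xget 0 P = w by exact: cg.
  have [exP|nexP] := pselect (exists g, P g).
    by have := xgetPex 0 exP; rewrite cgE => -[_]; exact.
  case: G_not0; have w0 : w = 0.
    by rewrite -cgE; apply: xgetPN => g Pg; apply: nexP; exists g.
  by rewrite -w0; exact: relintW.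
apply: is_derive_lineE.
have -> : (fun x : R => Fstar (y + x *: k)) =
    (fun x : R => Fstar (h + x *: k) + pairing (y - h) w).
  apply/funext => x; rewrite -(conjugate_shift _ yw) -/h; congr Fstar.
  by rewrite addrAC addrCA subrr addr0.
have : is_derive (0 : R) 1 (fun x : R => Fstar (h + x *: k)) (pairing w k).
  by apply: is_derive_line; rewrite scale0r addr0.
by move=> ?; apply: is_derive_eq; rewrite addr0.
Qed.

(** [w] represents the derivative in every direction, and such a vector is unique: test on the
    difference. Costs outside [dirG] are thus covered by the mirror step. *)
Lemma conj_gradientE y w : dual_point y w -> conj_gradient G F y = w.
Proof.
move=> yw.
pose P := [set g | [set: E] g /\ forall k, [set: E] k -> is_derive y k Fstar (pairing g k)].
have Pw : P w by split=> // k _; exact: is_derive_conjugate.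
have [_ Pg] : P (conj_gradient G F y) by apply: (xgetPex 0); exists w.
apply/eqP; rewrite -subr_eq0; apply/eqP; apply: pairing_self_eq0.
set g := conj_gradient G F y in Pg *.
rewrite pairingBl; have [_ <-] := Pg (g - w) I.
by have [_ <-] := Pw.2 (g - w) I; rewrite subrr.
Qed.

(** Above, the maximiser [w] is confronted with the lower estimate on [F]; below, test points in
    Dikin's ellipsoid are confronted with the upper one. *)
Local Lemma conjugate_taylor v f s : relG v -> `|s| * dual_local_norm v f <= 1 / 8 ->
  `|Fstar (gradient G F v + s *: f) - Fstar (gradient G F v) - s * pairing v f -
     (`|s| * dual_local_norm v f) ^+ 2 / 2| <= 2 * (`|s| * dual_local_norm v f) ^+ 3.
Proof.
move=> Gv a8; set h := gradient G F v.
set L := dual_local_norm v f in a8 *; set a := `|s| * L in a8 *.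
have L0 : 0 <= L by exact: dual_local_norm_ge0.
have a0 : 0 <= a by rewrite mulr_ge0.
have hE : Fstar h = pairing h v - F v by apply: conjugateE; exact: dual_point_gradient.
set psi := Fstar _ - Fstar h - s * pairing v f.
have psi_ge w : relG w -> s * pairing f (w - v) - (F w - F v - pairing h (w - v)) <= psi.
  move=> Gw; have := fenchel_young (h + s *: f) Gw.
  rewrite /psi hE !(pairingBr, pairingDl, pairingZl) (pairingC v f); lra.
suff lo : a ^+ 2 * (1 / 2 - 2 * a) <= psi /\ psi <= a ^+ 2 / 2 + 2 * a ^+ 3.
  rewrite ler_norml; apply/andP; split; last by lra.
  have : a ^+ 2 * (1 / 2 - 2 * a) = a ^+ 2 / 2 - 2 * a ^+ 3 by field.
  by lra.
split; last first.
  have [w yw] := dual_point_ex (h + s *: f) (ex_intro _ v Gv).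
  have [Gw _] := yw; have Gk : dirG (w - v) by apply: directionB; exact: relintW.
  have := gradient_lower Gv Gw; rewrite -/h; set r := local_norm F v _ => low.
  have r0 : 0 <= r by exact: local_norm_ge0.
  apply: le_trans (conj_local_upper a0 _ r0); last by lra.
  have : s * pairing f (w - v) <= a * r.
    apply: (le_trans (ler_norm _)); rewrite normrM /a -mulrA ler_wpM2l//.
    exact: pairing_le_dual.
  rewrite /psi hE (conjugateE yw).
  move: low; rewrite !(pairingBr, pairingDl, pairingZl) (pairingC v f); lra.
have a12 : 0 < 1 / 2 - 2 * a by lra.
have [s0|s0] := eqVneq s 0.
  have := psi_ge v Gv; rewrite !subrr !pairing0r !mulr0 !subr0 /a s0 normr0.
  by rewrite !mul0r expr0n mul0r.
have s2 : 0 < s ^+ 2 by rewrite exprn_even_gt0.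
(* The lower bound reads [L ^+ 2 <= X]; bounding every quotient by [sqrt X] spares the choice of a
   maximising direction. *)
pose X := psi / (s ^+ 2 * (1 / 2 - 2 * a)).
have den0 : 0 < s ^+ 2 * (1 / 2 - 2 * a) by rewrite mulr_gt0.
suff LX : L <= Num.sqrt X.
  have X0 : 0 <= X.
    apply: divr_ge0; last exact: ltW.
    by have := psi_ge v Gv; rewrite !subrr !pairing0r mulr0 !subr0.
  have : L ^+ 2 <= X by rewrite -[leRHS]sqr_sqrtr// ler_pXn2r ?nnegrE ?sqrtr_ge0.
  rewrite ler_pdivlMr// mulrA; congr (_ * _ <= _).
  by rewrite /a exprMn real_normK ?num_real// mulrC.
apply: ge_sup; first exact: (has_sup_dual f Gv).1.
move=> _ [k0 Gk0 <-].
have Gk0N : dirG (- k0) by apply: directionN => //; exists v; exact: relintW.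
(* The sign of [k0] is chosen so that moving along [k] increases [s * pairing f _]. *)
have [k [Gk sk -> ->]] : exists k, [/\ dirG k, s * pairing f k = `|s| * `|pairing f k|,
    `|pairing f k0| = `|pairing f k| & local_norm F v k0 = local_norm F v k].
  have [sf|sf] := lerP 0 (s * pairing f k0).
    by exists k0; rewrite -normrM ger0_norm.
  by exists (- k0); rewrite pairingNr normrN local_normN mulrN -normrM ltr0_norm.
have c_le : `|pairing f k| / local_norm F v k <= L by exact: dual_local_norm_ge.
move: c_le; set r := local_norm F v k; set c := _ / r => c_le.
have r_ge0 : 0 <= r by exact: local_norm_ge0.
have c0 : 0 <= c by exact: divr_ge0.
have [r0|r0] := eqVneq r 0; first by rewrite /c r0 invr0 mulr0 sqrtr_ge0.
have rp : 0 < r by rewrite lt_neqAle eq_sym r0.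
have cr : `|pairing f k| = c * r by rewrite /c divfK.
rewrite -[c]ger0_norm// -sqrtr_sqr; apply: ler_wsqrtr.
rewrite ler_pdivlMr//.
(* A step of local length [x] maximises the quadratic model [x * t - t ^+ 2 / 2]; its linear gain is
   [x ^+ 2]. *)
set x := `|s| * c.
have x0 : 0 <= x by exact: mulr_ge0.
have xa : x <= a by exact: ler_wpM2l.
have rb : r * (x / r) = x by rewrite mulrC divfK.
have b0 : 0 <= x / r by exact: divr_ge0.
have rb1 : r * (x / r) < 1 by rewrite rb; lra.
have := psi_ge _ (dikin G_closed G_convex hF Gv Gk b0 rb1).
have := barrier_upper G_closed G_convex hF Gv Gk b0 rb1.
rewrite -/r rb (gradientP Gv).2// -/h.
have -> : v + (x / r) *: k - v = (x / r) *: k by rewrite addrAC subrr add0r.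
rewrite !pairingZr [s * (x / r * _)]mulrCA sk cr.
have -> : x / r * (`|s| * (c * r)) = x ^+ 2 by rewrite /x; field.
have x4 : x <= 1 / 4 by lra.
have low := conj_local_lower x0 x4 => up psi_low.
have -> : c ^+ 2 * (s ^+ 2 * (1 / 2 - 2 * a)) = x ^+ 2 * (1 / 2 - 2 * a).
  have -> : s ^+ 2 = `|s| ^+ 2 by rewrite real_normK ?num_real.
  by rewrite /x; ring.
have : x ^+ 2 * (1 / 2 - 2 * a) <= x ^+ 2 * (1 / 2 - 2 * x).
  by apply: ler_wpM2l; [exact: sqr_ge0|lra].
lra.
Qed.

(** [psi] is the conjugate along [f] minus its affine part at 0, and [d] its derivative.
    Fenchel-Young at the dual point gives the subgradient inequality that [convex_taylor2] asks
    for. *)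
Local Lemma derive2_conjugate v f : relG v ->
  'D_f ('D_f Fstar) (gradient G F v) = dual_local_norm v f ^+ 2.
Proof.
move=> Gv; set h := gradient G F v; set L := dual_local_norm v f.
pose d s := 'D_f Fstar (h + s *: f) - pairing v f.
pose psi s := Fstar (h + s *: f) - Fstar h - s * pairing v f.
have dE y w : dual_point y w -> 'D_f Fstar y = pairing w f.
  by move=> yw; have [_ ->] := is_derive_conjugate f yw.
have d0 : 'D_f Fstar h = pairing v f by apply: dE; exact: dual_point_gradient.
have sub s s' : psi s + (s' - s) * d s <= psi s'.
  have [w yw] := dual_point_ex (h + s *: f) (ex_intro _ v Gv).
  have := fenchel_young (h + s' *: f) yw.1.
  rewrite /psi /d (dE _ _ yw) (conjugateE yw) !(pairingDl, pairingZl) (pairingC w f).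
  by lra.
have := convex_taylor2 (dual_local_norm_ge0 f Gv) _ sub.
move=> /(_ (fun s => conjugate_taylor Gv)) cv.
apply: cvg_lim => //; apply: cvg_trans cv.
rewrite (_ : (fun s : R => s^-1 * d s) = (fun s : R => s^-1 *:
  (('D_f Fstar \o shift h) (s *: f) - 'D_f Fstar h)))//.
by apply/funext => s /=; rewrite /d d0 [h + _]addrC.
Qed.

Lemma dual_normE v f : relG v ->
  dual_norm G F (gradient G F v) f = dual_local_norm v f.
Proof.
move=> Gv; rewrite /dual_norm derive2_conjugate// sqrtr_sqr ger0_norm//.
exact: dual_local_norm_ge0.
Qed.

(** * Mirror descent steps and their telescoped regret *)

Lemma mirror_step_regret v w mu f (rho : R) : relG v ->
  dual_point (gradient G F v - rho *: f) w -> relG mu ->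
  rho * pairing (v - mu) f =
    bregman G F mu v - bregman G F mu w + bregman G F v w.
Proof.
move=> Gv [Gw yw] Gmu; rewrite /bregman.
(* The step relation for the gradient at [w] holds only against directions, such as these two
   differences. *)
have Gk : dirG (mu - w) by apply: directionB; exact: relintW.
have Gk' : dirG (v - w) by apply: directionB; exact: relintW.
rewrite -!yw// !(pairingBr, pairingBl, pairingZl) (pairingC v f) (pairingC mu f).
by ring.
Qed.

(** The divergences from [v] to [w] and back add up to [- rho * pairing f (w - v)], and
    self-concordance bounds the second one below. *)
Lemma bregman_step_le v w f (rho : R) : 0 <= rho -> relG v ->
  dual_point (gradient G F v - rho *: f) w ->
  rho * dual_norm G F (gradient G F v) f <= 1 / 2 ->
  bregman G F v w <= 2 * (rho * dual_norm G F (gradient G F v) f) ^+ 2.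
Proof.
move=> rho0 Gv [Gw yw]; rewrite dual_normE// => a2.
set a := rho * _ in a2 *.
have a0 : 0 <= a by rewrite mulr_ge0// dual_local_norm_ge0.
have Gk : dirG (w - v) by apply: directionB; exact: relintW.
have Gk' : dirG (v - w) by apply: directionB; exact: relintW.
apply: le_trans (conj_local_bound a0 a2 (local_norm_ge0 F v (w - v))).
have := gradient_lower Gv Gw.
have : - (rho * pairing f (w - v)) <= a * local_norm F v (w - v).
  apply: (le_trans (ler_norm _)); rewrite normrN normrM ger0_norm// /a -mulrA.
  by rewrite ler_wpM2l//; exact: pairing_le_dual.
rewrite /bregman -yw// !(pairingBr, pairingBl, pairingZl); lra.
Qed.

Lemma bregman_ge0 v w : relG v -> relG w -> 0 <= bregman G F v w.
Proof. by move=> Gv Gw; have := gradient_tangent Gw Gv; rewrite /bregman; lra. Qed.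

Lemma mirror_descent_regret (rho : R) (T : nat) (f nu : nat -> E) mu :
  0 < rho -> mirror_descent G F rho T f nu ->
  (forall t : nat, (1 <= t <= T)%N ->
     rho * dual_norm G F (gradient G F (nu t)) (f t) <= 1 / 2) ->
  (forall t : nat, (1 <= t <= T)%N -> dual_norm G F (gradient G F (nu t)) (f t) <= 1) ->
  relG mu ->
  \sum_(1 <= t < T.+1) pairing (nu t) (f t) - \sum_(1 <= t < T.+1) pairing mu (f t) <=
    bregman G F mu (nu 1%N) * rho^-1 + 2 * rho * T%:R.
Proof.
move=> rho0 [Gnu1 _ nuE] rho_f f1 Gmu.
have step (t : nat) : (1 <= t <= T)%N -> relG (nu t) ->
    dual_point (gradient G F (nu t) - rho *: f t) (nu t.+1).
  move=> tT Gt; have [w yw] := dual_point_ex (gradient G F (nu t) - rho *: f t)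
    (ex_intro _ _ Gt).
  by rewrite (nuE t.+1 tT) (conj_gradientE yw).
have Gnu (t : nat) : (1 <= t <= T.+1)%N -> relG (nu t).
  case: t => [//|t]; elim: t => [_|t IH tT]; first exact: Gnu1.
  exact: (step t.+1 tT (IH (ltnW tT))).1.
(* Multiplied by [rho] and keeping the last divergence, so that the induction telescopes; that
   divergence is finally dropped as nonnegative. *)
suff H N : (N <= T)%N -> rho * (\sum_(1 <= t < N.+1) pairing (nu t) (f t) -
    \sum_(1 <= t < N.+1) pairing mu (f t)) <=
    bregman G F mu (nu 1%N) - bregman G F mu (nu N.+1) + 2 * rho ^+ 2 * N%:R.
  have := H T (leqnn T); have := bregman_ge0 Gmu (Gnu T.+1 (leqnn _)).
  move=> b0 HT; rewrite -(ler_pM2l rho0) [leRHS]mulrDr mulrCA divff ?gt_eqF// mulr1.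
  by apply: (le_trans HT); rewrite -subr_ge0; nra.
elim: N => [|N IH] NT.
  by rewrite !big_geq// !subrr !mulr0 addr0.
have tT : (1 <= N.+1 <= T)%N by [].
have GN : relG (nu N.+1) by apply: Gnu; exact: leqW.
rewrite -[N.+1%:R]natr1 !(@big_nat_recr _ _ _ N.+1 1)//=.
have := IH (ltnW NT).
have := mirror_step_regret GN (step _ tT GN) Gmu.
have := bregman_step_le (ltW rho0) GN (step _ tT GN) (rho_f _ tT).
(* Dual norms at most 1 make each round cost at most [2 * rho ^+ 2]. *)
have : (rho * dual_norm G F (gradient G F (nu N.+1)) (f N.+1)) ^+ 2 <= rho ^+ 2.
  rewrite exprMn ler_piMr ?sqr_ge0// exprn_ile1 ?f1//.
  by rewrite dual_normE// dual_local_norm_ge0.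
rewrite pairingBl; set S1 := \sum_(_ <= _ < _) _; set S2 := \sum_(_ <= _ < _) _.
lra.
Qed.

End Duality.

(** * Regret over the state-action polytope, in the extended reals *)

Theorem theorem5 (R : realType) (n m : nat)
    (K : 'I_n -> 'I_m -> 'I_n -> R) (hK : transition_kernel K)
    (G : set 'M[R]_(n, m)) (hG : G = state_action_polytope K)
    (G_compact : compact G) (G_convex : convex_set G)
    (G_int : relint G !=set0)
    (calF : set 'M[R]_(n, m)) (T : nat)
    (F : 'M[R]_(n, m) -> R) (hF : mirror_barrier G F)
    (G' : set 'M[R]_(n, m)) (hG' : G' `<=` relint G)
    (rho : R) (hrho : 0 < rho)
    (f nu : nat -> 'M[R]_(n, m))
    (hf : forall t, (1 <= t <= T)%N -> calF (f t))
    (hnu : mirror_descent G F rho T f nu)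
    (hrho_f : forall t, (1 <= t <= T)%N ->
       rho * dual_norm G F (gradient G F (nu t)) (f t) <= 1 / 2)
    (hf1 : forall t, (1 <= t <= T)%N ->
       dual_norm G F (gradient G F (nu t)) (f t) <= 1)
    (Vhat : nat -> \bar R)
    (hVhat : forall t, (t <= T)%N ->
       Vhat t = mirror_relaxation G F rho T f nu G' t) :
  (online_regret T f nu G' <=
   bregman_radius G F (nu 1%N) G' * (rho^-1)%:E + (2 * rho * T%:R)%:E)%E.
Proof.
have G_closed : closed G.
  by apply: compact_closed => //; exact: norm_hausdorff.
have G_bounded g : exists B, forall v, G v -> `|pairing v g| <= B.
  have [M [_ HM]] := compact_bounded G_compact.
  exists ((M + 1) * \sum_i \sum_j `|g i j|) => v Gv.
  apply: (le_trans (pairing_le_norm v g)); apply: ler_wpM2r.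
    by apply: sumr_ge0 => i _; apply: sumr_ge0.
  by apply: (HM (M + 1)) => //; rewrite ltrDl.
have G_not0 : ~ G 0.
  rewrite hG => -[_ + _].
  under eq_bigr do under eq_bigr do rewrite mxE.
  under eq_bigr do rewrite big1//.
  by rewrite big1// => /eqP; rewrite eq_sym oner_eq0.
have regret mu (G'mu : G' mu) := mirror_descent_regret G_closed G_convex hF G_bounded
  G_not0 hrho hnu hrho_f hf1 (hG' mu G'mu).
rewrite /online_regret; set S := \sum_(_ <= _ < _) _.
(* For empty [G'] the infimum is [+oo] and the regret [-oo]. *)
have [->|/set0P[mu0 G'mu0]] := eqVneq G' set0.
  by rewrite image_set0 ereal_inf0 /= leNye.
have rad_ge mu : G' mu -> ((bregman G F mu (nu 1%N))%:E <=
    bregman_radius G F (nu 1%N) G')%E.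
  by move=> G'mu; apply: ereal_sup_ubound; exists mu.
(* A radius [+oo] makes the bound trivial, and [-oo] is excluded by the point [mu0]. *)
move: rad_ge; case: (bregman_radius _ _ _ _) => [r| |] rad_ge.
- have : ((S - (r * rho^-1 + 2 * rho * T%:R))%:E <= ereal_inf
      [set (\sum_(1 <= t < T.+1) pairing v (f t))%:E | v in G'])%E.
    apply: le_ereal_inf_tmp => _ [mu G'mu <-]; rewrite lee_fin.
    have := rad_ge mu G'mu; rewrite lee_fin => mu_r.
    have : bregman G F mu (nu 1%N) * rho^-1 <= r * rho^-1.
      by rewrite ler_wpM2r// invr_ge0 ltW.
    have := regret mu G'mu; rewrite -/S; lra.
  case: (ereal_inf _) => [i| |] //=; last by move=> _; rewrite addeNy leNye.
  rewrite lee_fin -EFinB -EFinM -EFinD lee_fin; lra.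
- by rewrite gt0_mulye ?lte_fin ?invr_gt0// addye// leey.
- by have := rad_ge _ G'mu0.
Qed.
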